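(* Let $a,b,c,d\in\mathbb{Q}_{\ge 0}$ and $h\in\{2,3\}$. For each $r\in\mathbb{Q}_{\ge 0}$, there are $x,y,z,w\in\mathbb{Q}_{\ge 0}$ such that $r=x^2+y^2+z^2+w^2$ and $ax+by+cz+dw\in\mathbb{Q}^h$. Moreover, there is a positive integer $N$ depending only on $a,b,c,d$ such that any $r\in\mathbb{N}$ can be written as $x^2+y^2+z^2+w^2$ with $x,y,z,w\in\mathbb{N}/N$ and $ax+by+cz+dw\in\mathbb{Q}^h$.
   Context: $\mathbb{N}=\{0,1,2,\ldots\}$; $\mathbb{Q}_{\ge 0}$ is the set of nonnegative rational numbers; for $h\in\{2,3\}$, $\mathbb{Q}^h=\{t^h: t\in\mathbb{Q}\}$ (not a Cartesian power); for a positive integer $N$, $\mathbb{N}/N=\{k/N: k\in\mathbb{N}\}$. *)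

(* Defs.v *)
From mathcomp Require Import all_boot all_order all_algebra.

Set Implicit Arguments.
Unset Strict Implicit.
Unset Printing Implicit Defensive.

Import Order.TTheory GRing.Theory Num.Theory.
Local Open Scope ring_scope.

Definition is_rat_power (h : nat) (q : rat) : Prop := exists t : rat, q = t ^+ h.

Definition in_nat_over (N : nat) (q : rat) : Prop :=
  exists k : nat, q = k%:R / N%:R.

(* Main.v *)
Require Import Defs.
From Stdlib Require Import ZArith Lia.
From mathcomp Require Import all_boot all_order all_algebra.
From mathcomp Require Import ssrZ zify.

(** Why the theorem holds.

    After clearing denominators, let A, B, C, D be natural coefficients, not
    all zero, and n = A^2 + B^2 + C^2 + D^2. If m = n r k^(2h) equals
    s^2 + p^2 + q^2 + u^2, then the product of the quaternion
    A + B i + C j + D k by s + p i + q j + u k has coordinates X, Y, Z, W with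
    X^2 + Y^2 + Z^2 + W^2 = n m and A X + B Y + C Z + D W = n s. Division by
    n k^h turns them into a representation of r on which the linear form takes
    the value s / k^h. It remains to find s = t^h close to the square root of
    m with m - s^2 a sum of three squares: if n (m - s^2) <= s^2, then
    Cauchy-Schwarz makes every coordinate whose coefficient is positive
    nonnegative, and the others may be replaced by their absolute values.
    The factor k depends on n only; it is odd, so that powers of 4 dividing m
    come from n r, and so large that m - t^(2h) is small for the last t below
    the root in any class modulo 4 ([close_power]). A suitable class for t
    always exists by looking at m modulo 8 ([good_residue]).

    Only two cases of Legendre's three-square theorem enter: numbers congruent
    to 3 modulo 8 ([three_odd_squares]), and numbers congruent to 1 or 2
    modulo 4 ([three_squares_mod4]). Instead of Minkowski's theorem and primes
    in progressions, the proof compares two counts.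

    A quadruple (s, form) of an integer and a binary quadratic form is an
    integral 2 x 2 matrix: the form is the symmetric part, s the antisymmetric
    one, and the determinant is s^2 plus the determinant of the form. A group
    generated by three (or four) reflections acts by multiplication on the
    left; the resulting graph is a forest, and following the reduction of the
    form orients it with one sink per tree, the sinks being the reduced forms.
    Stretching one column of the matrix by a factor commutes with the action,
    so it gives a second orientation of the same forest. Its sinks, for a large
    factor, are matrices in Hermite normal form, which are counted by the sum
    of divisors. As any two orientations have equally many sinks
    ([size_sinks]), this yields a class number relation of Kronecker and
    Hurwitz: the reduced forms of determinant M - s^2, summed over s, are
    counted by sigma ([size_sinksB], [size_formsA_sum]).

    By Jacobi's theorem on four odd squares ([jacobi_four_odd_squares], from a
    recursion shared by both sides) the representations of M - s^2 by three
    squares, summed over s, are counted by sigma as well. Induction then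
    equates the terms one by one, so the representations of a number by three
    squares are equinumerous with reduced forms of that determinant
    ([size_reps3_forms3], [size_mixed_formsA]), and a reduced form can be
    written down. *)

Set Implicit Arguments.
Unset Strict Implicit.
Unset Printing Implicit Defensive.

Import Order.TTheory GRing.Theory Num.Theory.

Delimit Scope Z_scope with ZZ.

(** * Finite sets given by enumerations *)

(** Cardinalities of sets of integer tuples are taken as sizes of
    duplicate-free lists, since the ambient types are infinite. *)
Definition enumerates (T : eqType) (P : pred T) (l : seq T) : Prop :=
  uniq l /\ forall v, (v \in l) = P v.

Lemma enumerates_perm (T : eqType) (P Q : pred T) (l m : seq T) :
  enumerates P l -> enumerates Q m -> P =1 Q -> perm_eq l m.
Proof.
move=> [ul ml] [um mm] PQ; apply: uniq_perm => // v.
by rewrite ml mm PQ.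
Qed.

Lemma enumerates_filter (T : eqType) (P Q : pred T) (l : seq T) :
  enumerates P l -> (forall v, Q v -> P v) -> enumerates Q (filter Q l).
Proof.
move=> [ul ml] QP; split; first exact: filter_uniq.
by move=> v; rewrite mem_filter ml; case Qv: (Q v) => //=; rewrite QP.
Qed.

Lemma enumerates_map (T U : eqType) (P : pred T) (Q : pred U) (l : seq T)
    (f : T -> U) (g : U -> T) :
  enumerates P l -> (forall v, P v -> Q (f v) /\ g (f v) = v) ->
  (forall w, Q w -> P (g w) /\ f (g w) = w) -> enumerates Q (map f l).
Proof.
move=> [ul ml] PQ QP; split.
  rewrite map_inj_in_uniq // => x y; rewrite !ml => /PQ[_ {2}<-] /PQ[_ {2}<-] ->.
  by [].
move=> w; apply/mapP/idP => [[v]|/QP[Pg fg]]; first by rewrite ml => /PQ[Qf _] ->.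
by exists (g w); rewrite ?ml.
Qed.

(** A set that is the disjoint union of one half and its mirror image under an
    involution; used with the sign change of all coordinates. *)
Lemma enumerates_double (T : eqType) (P Q : pred T) (neg : T -> T) (l : seq T) :
  involutive neg -> (forall v, Q v -> ~~ Q (neg v)) -> (forall v, P v = Q v || Q (neg v)) ->
  enumerates Q l -> enumerates P (l ++ map neg l).
Proof.
move=> negK dis PQ [ul ml]; have ninj := can_inj negK; split.
  rewrite cat_uniq ul map_inj_uniq // ul andbT; apply/hasPn => _ /mapP[w wl ->].
  by rewrite ml dis // -ml.
by move=> v; rewrite mem_cat ml PQ -{2}[v]negK mem_map // ml.
Qed.

Lemma enumerates_fibers (S T : eqType) (P : pred (S * T)) (r : seq S)
    (l : S -> seq T) :
  uniq r -> (forall s w, P (s, w) -> s \in r) ->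
  (forall s, s \in r -> enumerates (fun w => P (s, w)) (l s)) ->
  enumerates P [seq (s, w) | s <- r, w <- l s].
Proof.
move=> ur Pr Pl; split.
  apply: allpairs_uniq_dep => //; first by move=> s /Pl[].
  by move=> [s w] [s' w'] _ _ [-> ->].
move=> [s w]; apply/allpairsPdep/idP => [[s' [w' [s'r w'l [-> ->]]]]|Psw].
  by have [_ <-] := Pl _ s'r.
have sr := Pr _ _ Psw; exists s, w; split => //.
by have [_ ->] := Pl _ sr.
Qed.

Lemma sum_enumerates_bij (R : nmodType) (T U : eqType) (P : pred T) (Q : pred U)
    (l : seq T) (m : seq U) (f : T -> U) (g : U -> T) (F : U -> R) :
  enumerates P l -> enumerates Q m ->
  (forall v, P v -> Q (f v) /\ g (f v) = v) ->
  (forall w, Q w -> P (g w) /\ f (g w) = w) ->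
  (\sum_(w <- m) F w = \sum_(v <- l) F (f v))%R.
Proof.
move=> lP mQ PQ QP; have lQ := enumerates_map lP PQ QP.
rewrite (perm_big _ (enumerates_perm mQ lQ (fun=> erefl))) /=.
by rewrite big_map.
Qed.

(** Summing first over the fibers of the first projection: this turns a count
    of pairs into a sum over s of counts depending on s. *)
Lemma sum_enumerates_fibers (R : nmodType) (S T : eqType) (P : pred (S * T))
    (L : seq (S * T)) (r : seq S) (l : S -> seq T) (F : S -> T -> R) :
  enumerates P L -> uniq r -> (forall s w, P (s, w) -> s \in r) ->
  (forall s, s \in r -> enumerates (fun w => P (s, w)) (l s)) ->
  (\sum_(v <- L) F v.1 v.2 = \sum_(s <- r) \sum_(w <- l s) F s w)%R.
Proof.
move=> LP ur Pr Pl; have fP := enumerates_fibers ur Pr Pl.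
by rewrite (perm_big _ (enumerates_perm LP fP (fun=> erefl))) /= big_allpairs_dep.
Qed.

Lemma size_enumerates_fibers (S T : eqType) (P : pred (S * T))
    (L : seq (S * T)) (r : seq S) (l : S -> seq T) :
  enumerates P L -> uniq r -> (forall s w, P (s, w) -> s \in r) ->
  (forall s, s \in r -> enumerates (fun w => P (s, w)) (l s)) ->
  (size L = \sum_(s <- r) size (l s))%N.
Proof.
move=> LP ur Pr Pl; have fP := enumerates_fibers ur Pr Pl.
by rewrite (perm_size (enumerates_perm LP fP (fun=> erefl))) size_allpairs_dep sumnE big_map.
Qed.

Definition zrange (B : Z) : seq Z :=
  [seq (Z.of_nat i - B)%ZZ | i <- iota 0 (Z.to_nat (2 * B + 1)%ZZ)].

Lemma mem_zrange B x : (x \in zrange B) = (Z.leb (Z.opp B) x && Z.leb x B).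
Proof.
apply/mapP/idP => [[i]|h]; first by rewrite mem_iota; lia.
exists (Z.to_nat (x + B)); last lia.
by rewrite mem_iota; lia.
Qed.

Lemma zrange_uniq B : uniq (zrange B).
Proof. rewrite map_inj_uniq ?iota_uniq // => i j; lia. Qed.

Definition zbox3 (B : Z) : seq (Z * Z * Z) :=
  [seq (p, c) | p <- [seq (a, b) | a <- zrange B, b <- zrange B], c <- zrange B].

Definition zbox2 (B : Z) : seq (Z * Z) := [seq (a, b) | a <- zrange B, b <- zrange B].

(** Counting along a relation rather than a function: the sink reached from a
    point is only known to exist. *)
Lemma size_le_rel (T U : eqType) (l : seq T) (m : seq U) (R : T -> U -> Prop) :
  uniq l -> (forall x, x \in l -> exists2 y, y \in m & R x y) ->
  (forall x x' y, R x y -> R x' y -> x = x') -> (size l <= size m)%N.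
Proof.
move=> + + Rinj; elim: l m => [//|x l IH] m /= /andP[xl ul] h.
have [y ym Rxy] := h x (mem_head _ _).
have := IH (rem y m) ul _; rewrite size_rem //.
have m0 : (0 < size m)%N by case: (m) ym.
have H : forall x', x' \in l -> exists2 y', y' \in rem y m & R x' y'.
  move=> x' x'l; have [|y' y'm Rxy'] := h x'; first by rewrite inE x'l orbT.
  exists y' => //; rewrite -[y' \in rem y m]/(y' \in rem y m).
  have ne : y' != y.
    by apply: contraNneq xl => e; rewrite e in Rxy'; rewrite (Rinj _ _ _ Rxy Rxy').
  by have := perm_mem (perm_to_rem ym) y'; rewrite inE (negbTE ne) /= => <-.
by move=> /(_ H); lia.
Qed.

(** * Sinks of an oriented forest *)

Definition follow (T : Type) (next : T -> option T) (v : T) : T := odflt v (next v).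

Definition drains (T : Type) (next : T -> option T) (v t : T) : Prop :=
  exists k, iter k (follow next) v = t /\ next t = None.

Lemma drains_step (T : Type) (next : T -> option T) (v w t : T) :
  next v = Some w -> drains next v t <-> drains next w t.
Proof.
move=> vw; have fv : follow next v = w by rewrite /follow vw.
split=> -[k [kt tN]].
  case: k kt => [/= e|k kt]; first by rewrite -e vw in tN.
  by exists k; split=> //; rewrite -fv -iterSr.
by exists k.+1; split=> //; rewrite iterSr fv.
Qed.

Lemma drains_fun (T : Type) (next : T -> option T) (v t t' : T) :
  drains next v t -> drains next v t' -> t = t'.
Proof.
have stay k u : next u = None -> iter k (follow next) u = u.
  by move=> uN; elim: k => //= k ->; rewrite /follow uN.
move=> [k [<- kN]] [k' [<- kN']]; case: (leqP k k') => h.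
  by rewrite -(subnK h) iterD (stay _ _ kN).
by rewrite -(subnK (ltnW h)) iterD (stay _ _ kN').
Qed.

(** Every vertex chooses at most one edge, every edge is chosen by one of its
    ends, and following choices terminates. A connected component then
    contains exactly one sink, as two paths of choices cannot diverge. *)
Definition oriented_by (T : Type) (V : T -> Prop) (adj : T -> T -> Prop)
    (next : T -> option T) : Prop :=
  [/\ forall v w, V v -> next v = Some w -> adj v w,
      forall v w, V v -> adj v w -> next v = Some w \/ next w = Some v
    & forall v, V v -> exists t, drains next v t].

(** Crossing an edge, in whichever direction it is oriented, does not change
    the final sink; so the sink is an invariant of the component. *)
Lemma drains_adj (T : Type) (V : T -> Prop) (adj : T -> T -> Prop)
    (next : T -> option T) (v w t : T) :
  oriented_by V adj next -> V v -> adj v w -> drains next v t <-> drains next w t.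
Proof.
by move=> [_ or _] Vv /(or _ _ Vv)[] e; have := drains_step t e; tauto.
Qed.

Lemma drains_drains (T : Type) (V : T -> Prop) (adj : T -> T -> Prop)
    (next next' : T -> option T) (v w t : T) :
  (forall v w, V v -> adj v w -> V w) ->
  oriented_by V adj next -> oriented_by V adj next' -> V v ->
  drains next' v w -> drains next v t <-> drains next w t.
Proof.
move=> Vadj or or' Vv [k [<- _]].
suff: V (iter k (follow next') v) /\
   (drains next v t <-> drains next (iter k (follow next') v) t) by case.
elim: k => //= k [Vk IH]; rewrite {1 3}/follow.
case e: (next' _) => [u|] //=; have a := let: And3 h _ _ := or' in h _ _ Vk e.
split; first exact: Vadj a.
by rewrite IH; exact: drains_adj or Vk a.
Qed.

Lemma drains_V (T : Type) (V : T -> Prop) (adj : T -> T -> Prop)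
    (next : T -> option T) (v w : T) :
  (forall v w, V v -> adj v w -> V w) ->
  oriented_by V adj next -> V v -> drains next v w -> V w.
Proof.
move=> Vadj [nx _ _] Vv [k [<- _]]; elim: k => //= k IH; rewrite /follow.
by case e: (next _) => [u|] //=; exact: Vadj (nx _ _ IH e).
Qed.

(** Both numbers equal the number of components: the sinks of one orientation
    are sent injectively to sinks of the other by following the latter. *)
Lemma size_sinks (T : eqType) (V : pred T) (adj : T -> T -> Prop)
    (next next' : T -> option T) (l l' : seq T) :
  (forall v w, V v -> adj v w -> V w) ->
  oriented_by V adj next -> oriented_by V adj next' ->
  enumerates (fun v => V v && (next v == None)) l ->
  enumerates (fun v => V v && (next' v == None)) l' -> size l = size l'.
Proof.
move=> Vadj.
suff le n1 n2 l1 l2 : oriented_by V adj n1 -> oriented_by V adj n2 ->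
    enumerates (fun v => V v && (n1 v == None)) l1 ->
    enumerates (fun v => V v && (n2 v == None)) l2 -> (size l1 <= size l2)%N.
  by move=> o o' e e'; apply/eqP; rewrite eqn_leq !(le _ _ _ _ _ _ e e', le _ _ _ _ _ _ e' e).
move=> o1 o2 [u1 m1] [u2 m2].
apply: (@size_le_rel _ _ _ _ (fun v t => [/\ V v, n1 v = None & drains n2 v t])) => //.
  move=> v; rewrite m1 => /andP[Vv /eqP vN].
  have [t vt] := let: And3 _ _ h := o2 in h _ Vv.
  exists t => //; rewrite m2 (drains_V Vadj o2 Vv vt) /=.
  by case: vt => k [_ ->].
move=> v v' t [Vv vN vt] [Vv' vN' vt'].
have dv : drains n1 v v by exists 0%N.
have dv' : drains n1 v' v' by exists 0%N.
apply: (drains_fun (v := t) (next := n1)).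
  by apply/(drains_drains v Vadj o1 o2 Vv vt).
by apply/(drains_drains v' Vadj o1 o2 Vv' vt').
Qed.

(** The measures decrease and then increase along a path, like lengths along a
    geodesic: once one of them has failed to decrease it never decreases
    again. Hence the sum of those that still decrease is strictly
    decreasing. *)
Lemma drains_exists (T : Type) (next : T -> option T) (V : T -> Prop)
    (ms : seq (T -> nat)) :
  (forall v w, V v -> next v = Some w -> V w) ->
  (forall v w, V v -> next v = Some w -> has (fun m => m w < m v)%N ms) ->
  (forall v w z, V v -> next v = Some w -> next w = Some z ->
     all (fun m => (m v <= m w) ==> (m w <= m z))%N ms) ->
  forall v, V v -> exists t, drains next v t.
Proof.
move=> Vn dec conv.
pose term v m := if next v is Some w then if (m w < m v)%N then m v else 0%N else 0%N.
pose Phi v := (\sum_(m <- ms) term v m)%N.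
suff H n v : (Phi v < n)%N -> V v -> exists t, drains next v t.
  by move=> v; apply: (H (Phi v).+1).
elim: n v => // n IH v Pv Vv.
case e: (next v) => [w|]; last by exists v, 0%N.
have Vw := Vn _ _ Vv e.
suff Pw : (Phi w < Phi v)%N.
  have [|//|t wt] := IH w; first exact: leq_trans Pw _.
  by exists t; apply/(drains_step _ e).
have le : all (fun m => term w m <= term v m)%N ms.
  case ew: (next w) => [z|]; last by elim: (ms) => //= m s ->; rewrite /term ew.
  have := conv _ _ _ Vv e ew; apply: sub_all => m; rewrite /term e ew.
  by do 2 case: ifP; lia.
have lt := dec _ _ Vv e; have := lt.
have lt' : has (fun m => term w m < term v m)%N ms.
  case ew: (next w) => [z|]; last first.
    by move: lt; apply: sub_has => m; rewrite /term ew e => h; rewrite h; lia.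
  by move: lt; apply: sub_has => m; rewrite /term e ew => h; rewrite h; case: ifP; lia.
move=> _; move: le lt'; rewrite /Phi; elim: (ms) => //= m s IHs /andP[lem les].
rewrite !big_cons => /orP[ltm|/(IHs les)]; last lia.
have : (\sum_(j <- s) term w j <= \sum_(j <- s) term v j)%N.
  move: les; elim: (s) => [|m' s' IHs'] /=; first by rewrite !big_nil.
  by move=> /andP[? /IHs']; rewrite !big_cons; lia.
lia.
Qed.

Local Open Scope Z_scope.

(** * The forest of ideal triangles *)

Definition quad : Type := (Z * (Z * Z * Z))%type.

(** The class 1 modulo 4 is preserved by the reflections below, and odd
    parameters stay off the walls of the reduction, where one of them
    vanishes. *)
Definition one4 (x : Z) : bool := Z.eqb (x mod 4) 1.

Definition one4_quad (v : quad) : bool :=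
  let: (s, (x, y, z)) := v in [&& one4 s, one4 x, one4 y & one4 z].

Definition sym2 (x y z : Z) : Z := x * y + y * z + z * x.

(** The determinant of the matrix with rows (x + y, y + s) and (y - s, y + z).
    Its symmetric part is the binary form with Selling parameters x, y, z, its
    antisymmetric part is s. *)
Definition disc (v : quad) : Z := let: (s, (x, y, z)) := v in s * s + sym2 x y z.

(** The symmetry of order 3 of the three Selling parameters. *)
Definition rot (v : quad) : quad := let: (s, (x, y, z)) := v in (s, (y, z, x)).

(** Left multiplication of the matrix by the reflection with rows (-1, 0) and
    (-2, 1); the two other generators are its conjugates by the rotation. *)
Definition flip0 (v : quad) : quad :=
  let: (s, (x, y, z)) := v in (x, (s, - (s + x + y), z + x - s)).

Definition same (a b : Z) : bool := (0 <? a) == (0 <? b).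

(** Parameters of one sign: the form is, up to sign, reduced in the sense of
    Selling. *)
Definition same3 (v : quad) : bool := let: (s, (x, y, z)) := v in same x y && same y z.

(** The side of the ideal triangle through which the reduction leaves. Unless
    all parameters agree in sign, one of them is opposite to the two others;
    together with s and the sums of two parameters it singles out one side, in
    such a way that crossing this side reverses the choice. *)
Definition leaves0 (v : quad) : bool :=
  let: (s, (x, y, z)) := v in
  [|| [&& ~~ same x y, ~~ same x z & if same s x then same (x + y) y else same (x + z) z],
      [&& ~~ same y x, ~~ same y z, ~~ same s y & ~~ same (y + x) x]
    | [&& ~~ same z x, ~~ same z y, same s z & ~~ same (z + x) x]].

Lemma one4E x : one4 x -> exists k : Z, x = 4 * k + 1.
Proof.
move/Z.eqb_eq => h; exists (x / 4).
by have := Z.div_mod x 4; rewrite h; apply.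
Qed.

(** Case analysis on the signs of all terms of a goal made of comparisons with
    0, pruned by linear arithmetic at every split. *)
Ltac split_signs :=
  rewrite ?/same;
  repeat (match goal with
  |- context [Z.ltb 0 ?t] => case: (Z.ltb_spec 0 t) => ?; cbn -[Z.add Z.mul Z.opp Z.sub]; try (exfalso; Lia.lia)
  end).

(** Each edge is chosen by exactly one of its two ends. *)
Lemma leaves0_flip v : one4_quad v -> leaves0 (flip0 v) = ~~ leaves0 v.
Proof.
move: v => [s [[x y] z]] /and4P[].
move=> /one4E[s' ->] /one4E[x' ->] /one4E[y' ->] /one4E[z' ->].
rewrite /leaves0 /flip0.
by split_signs.
Qed.

Lemma leaves_total v : one4_quad v ->
  [|| same3 v, leaves0 v, leaves0 (rot v) | leaves0 (rot (rot v))].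
Proof.
move: v => [s [[x y] z]] _; rewrite /leaves0 /same3 /rot.
by split_signs.
Qed.

Lemma leaves0_disjoint v : ~~ (leaves0 v && leaves0 (rot v)).
Proof.
by move: v => [s [[x y] z]]; rewrite /leaves0 /rot; split_signs.
Qed.

Lemma same3_leaves0 v : same3 v -> leaves0 v = false.
Proof.
by move: v => [s [[x y] z]]; rewrite /leaves0 /same3; split_signs.
Qed.

(** The hexagonal norm |p| + |q| + |p - q| of the first column (p, q) of the
    matrix. *)
Definition hexnorm (v : quad) : Z :=
  let: (s, (x, y, z)) := v in Z.abs (x + y) + Z.abs (s - y) + Z.abs (s + x).

Definition unflip1 (v : quad) : quad := rot (rot (flip0 (rot v))).
Definition unflip2 (v : quad) : quad := rot (flip0 (rot (rot v))).

Lemma abs_ltb a b : (Z.abs a <? Z.abs b) =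
  ((0 <? b - a) && (0 <? b + a)) || ((0 <? a - b) && (0 <? - a - b)).
Proof.
case: (Z.ltb_spec (Z.abs a) (Z.abs b)) => ?.
all: by split_signs.
Qed.

(** Of the three terms of the norm only one is changed by the reflection, and
    it decreases exactly when two sums have opposite signs. *)
Lemma hexnorm_flip0 s x y z :
  (hexnorm (flip0 (s, (x, y, z))) <? hexnorm (s, (x, y, z))) =
  (0 <? x + y) && (0 <? - (x + s)) || (0 <? - (x + y)) && (0 <? x + s).
Proof.
have -> : (hexnorm (flip0 (s, (x, y, z))) <? hexnorm (s, (x, y, z))) =
   (Z.abs (2 * x + y + s) <? Z.abs (s - y)).
  by rewrite /hexnorm /flip0; do 2 case: Z.ltb_spec => ? //; exfalso; Lia.lia.
rewrite abs_ltb.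
by split_signs.
Qed.

Lemma hexnorm_rot_flip0 s x y z :
  (hexnorm (rot (flip0 (s, (x, y, z)))) <? hexnorm (rot (s, (x, y, z)))) =
  (0 <? y + s) && (0 <? z - s) || (0 <? - (y + s)) && (0 <? s - z).
Proof.
have -> : (hexnorm (rot (flip0 (s, (x, y, z)))) <? hexnorm (rot (s, (x, y, z)))) =
   (Z.abs (z - y - 2 * s) <? Z.abs (y + z)).
  by rewrite /hexnorm /flip0 /rot; do 2 case: Z.ltb_spec => ? //; exfalso; Lia.lia.
rewrite abs_ltb.
by split_signs.
Qed.

Lemma hexnorm_rot2_flip0 s x y z :
  (hexnorm (rot (rot (flip0 (s, (x, y, z))))) <? hexnorm (rot (rot (s, (x, y, z))))) =
  (0 <? s - x) && (0 <? z + x) || (0 <? x - s) && (0 <? - (z + x)).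
Proof.
have -> : (hexnorm (rot (rot (flip0 (s, (x, y, z))))) <? hexnorm (rot (rot (s, (x, y, z))))) =
   (Z.abs (z + 2 * x - s) <? Z.abs (s + z)).
  by rewrite /hexnorm /flip0 /rot; do 2 case: Z.ltb_spec => ? //; exfalso; Lia.lia.
rewrite abs_ltb.
by split_signs.
Qed.

Lemma leaves0_decreases v : one4_quad v -> leaves0 v ->
  [|| hexnorm (flip0 v) <? hexnorm v, hexnorm (rot (flip0 v)) <? hexnorm (rot v)
    | hexnorm (rot (rot (flip0 v))) <? hexnorm (rot (rot v))].
Proof.
move: v => [s [[x y] z]] /and4P[].
move=> /one4E[s' ->] /one4E[x' ->] /one4E[y' ->] /one4E[z' ->].
rewrite hexnorm_flip0 hexnorm_rot_flip0 hexnorm_rot2_flip0 /leaves0.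
by split_signs.
Qed.

Lemma rot3 v : rot (rot (rot v)) = v.
Proof. by move: v => [s [[x y] z]]. Qed.

(** Norms of the two columns and of their difference: convex functions on the
    tree, at least one of which decreases along every chosen edge. *)
Definition hexnorms : seq (quad -> Z) := [:: hexnorm; hexnorm \o rot; hexnorm \o rot \o rot].

Lemma flip0_convex v : one4_quad v ->
  all (fun m => ((m v <=? m (flip0 v)) ==> (m (flip0 v) <=? m (unflip1 (flip0 v))))
             && ((m v <=? m (flip0 v)) ==> (m (flip0 v) <=? m (unflip2 (flip0 v)))))
    hexnorms.
Proof.
move: v => [s [[x y] z]] _.
rewrite /hexnorms /unflip1 /unflip2 /flip0 /rot /hexnorm /=.
rewrite andbT; apply/and3P; split; apply/andP; split; apply/implyP => /Z.leb_spec0 ?; apply/Z.leb_spec0.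
all: Lia.lia.
Qed.

(** Stretching the first column of the matrix by 2 k + 1. It commutes with the
    reflections, which act on the rows. *)
Definition scale (k : Z) (v : quad) : quad :=
  let: (s, (x, y, z)) := v in
  (s + k * (s - y),
   (x + 2 * k * (x + y) + k * (s - y), y - k * (s - y), z + k * (s - y))).

Lemma scale_flip0 k v : scale k (flip0 v) = flip0 (scale k v).
Proof. by move: v => [s [[x y] z]]; rewrite /scale /unflip1 /unflip2 /flip0 /rot; congr (_, (_, _, _)); ring. Qed.

Lemma scale_unflip1 k v : scale k (unflip1 v) = unflip1 (scale k v).
Proof. by move: v => [s [[x y] z]]; rewrite /scale /unflip1 /unflip2 /flip0 /rot; congr (_, (_, _, _)); ring. Qed.

Lemma scale_unflip2 k v : scale k (unflip2 v) = unflip2 (scale k v).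
Proof. by move: v => [s [[x y] z]]; rewrite /scale /unflip1 /unflip2 /flip0 /rot; congr (_, (_, _, _)); ring. Qed.

Lemma one4I k : one4 (4 * k + 1).
Proof. by apply/Z.eqb_spec; rewrite Z.mul_comm Z.add_comm Z_mod_plus_full. Qed.

Lemma one4_is x k : x = 4 * k + 1 -> one4 x.
Proof. by move=> ->; exact: one4I. Qed.

Lemma one4_scale k v : one4_quad v -> one4_quad (scale k v).
Proof.
move: v => [s [[x y] z]] /and4P[].
move=> /one4E[s' ->] /one4E[x' ->] /one4E[y' ->] /one4E[z' ->].
apply/and4P; split.
- by apply: (@one4_is _ (s' + k * (s' - y'))); Lia.lia.
- by apply: (@one4_is _ (x' + 2 * k * (x' + y') + k + k * (s' - y'))); Lia.lia.
- by apply: (@one4_is _ (y' - k * (s' - y'))); Lia.lia.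
- by apply: (@one4_is _ (z' + k * (s' - y'))); Lia.lia.
Qed.

Lemma one4_rot v : one4_quad v -> one4_quad (rot v).
Proof. by move: v => [s [[x y] z]] /and4P[? ? ? ?]; apply/and4P; split. Qed.

Lemma one4_flip0 v : one4_quad v -> one4_quad (flip0 v).
Proof.
move: v => [s [[x y] z]] /and4P[].
move=> /one4E[s' ->] /one4E[x' ->] /one4E[y' ->] /one4E[z' ->].
apply/and4P; split; rewrite ?one4I //.
- by apply: (@one4_is _ (- s' - x' - y' - 1)); Lia.lia.
- by apply: (@one4_is _ (z' + x' - s')); Lia.lia.
Qed.

Lemma flip0K v : flip0 (flip0 v) = v.
Proof. by move: v => [s [[x y] z]]; rewrite /scale /unflip1 /unflip2 /flip0 /rot; congr (_, (_, _, _)); ring. Qed.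

Lemma disc_flip0 v : disc (flip0 v) = - disc v.
Proof. by move: v => [s [[x y] z]]; rewrite /disc /flip0 /sym2; Lia.lia. Qed.

Lemma disc_rot v : disc (rot v) = disc v.
Proof. by move: v => [s [[x y] z]]; rewrite /disc /rot /sym2; Lia.lia. Qed.

(** The orientation read off after stretching: the edges do not depend on k,
    but the choices do. *)
Definition nextB (k : Z) (v : quad) : option quad :=
  let w := scale k v in
  if leaves0 w then Some (flip0 v)
  else if leaves0 (rot w) then Some (unflip1 v)
  else if leaves0 (rot (rot w)) then Some (unflip2 v) else None.

Definition adjB (v w : quad) : Prop := [\/ w = flip0 v, w = unflip1 v | w = unflip2 v].

Definition onB (N : Z) (v : quad) : bool :=
  one4_quad v && ((disc v == N) || (disc v == - N)).

Lemma onB_adj N v w : onB N v -> adjB v w -> onB N w.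
Proof.
move=> /andP[ov dv] vw; apply/andP; split.
  by case: vw => ->; rewrite /unflip1 /unflip2; do ![apply: one4_rot | apply: one4_flip0].
have -> : disc w = - disc v.
  by case: vw => ->; rewrite /unflip1 /unflip2 !(disc_rot, disc_flip0).
by move: dv => /orP[] /eqP ->; rewrite ?Z.opp_involutive eqxx ?orbT.
Qed.

Lemma nextB_adj k v w : nextB k v = Some w -> adjB v w.
Proof.
rewrite /nextB; case: ifP => _; first by move=> [<-]; exact: Or31.
case: ifP => _; first by move=> [<-]; exact: Or32.
by case: ifP => // _ [<-]; exact: Or33.
Qed.

Lemma nextB_oriented k v w : one4_quad v -> adjB v w ->
  nextB k v = Some w \/ nextB k w = Some v.
Proof.
move=> ov; have ou := one4_scale k ov; rewrite /nextB => -[] ->.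
- rewrite scale_flip0 flip0K leaves0_flip //.
  by case: (leaves0 (scale k v)); [left | right].
- rewrite scale_unflip1 /unflip1 rot3.
  set u := scale k v in ou *; have or := one4_rot ou.
  have := leaves0_disjoint (rot (rot (flip0 (rot u)))); rewrite rot3 leaves0_flip //.
  have := leaves0_disjoint u.
  case: (leaves0 (rot u)); rewrite /= ?andbT ?andbF.
    by move=> /negbTE -> _; left.
  by move=> _ /negbTE ->; right; rewrite ?rot3 flip0K ?rot3.
- rewrite scale_unflip2 /unflip2 rot3.
  set u := scale k v in ou *; have or := one4_rot (one4_rot ou).
  have := leaves0_disjoint (flip0 (rot (rot u))); rewrite leaves0_flip //.
  have := leaves0_disjoint (rot (rot u)); rewrite rot3; have := leaves0_disjoint (rot u).
  have := leaves0_disjoint (rot (rot (flip0 (rot (rot u))))).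
  rewrite !rot3 leaves0_flip //.
  case: (leaves0 (rot (rot u))); rewrite /= ?andbT ?andbF.
    by move=> _ /negbTE -> /negbTE -> _; left.
  by move=> /negbTE -> _ _ /negbTE ->; right; rewrite ?rot3 flip0K ?rot3.
Qed.

Lemma unflip1_hexnorms v : one4_quad v -> leaves0 (rot v) ->
  has (fun m => m (unflip1 v) <? m v) hexnorms.
Proof.
move=> /one4_rot or /(leaves0_decreases or); rewrite /= /unflip1 !rot3.
by rewrite !orbF => /or3P[] ->; rewrite ?orbT.
Qed.

Lemma unflip2_hexnorms v : one4_quad v -> leaves0 (rot (rot v)) ->
  has (fun m => m (unflip2 v) <? m v) hexnorms.
Proof.
move=> /one4_rot/one4_rot or /(leaves0_decreases or); rewrite /= /unflip2 !rot3.
by rewrite !orbF => /or3P[] ->; rewrite ?orbT.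
Qed.

Lemma hexnorm_ge0 v : 0 <= hexnorm v.
Proof. by move: v => [s [[x y] z]]; rewrite /hexnorm; Lia.lia. Qed.

Lemma nextB_decreases k v w : one4_quad v -> nextB k v = Some w ->
  has (fun m => m (scale k w) <? m (scale k v)) hexnorms.
Proof.
move=> ov; have ou := one4_scale k ov; rewrite /nextB.
case: ifP => [p [<-]|_]; first by rewrite scale_flip0; have := leaves0_decreases ou p; rewrite /= orbF.
case: ifP => [p [<-]|_]; first by rewrite scale_unflip1; exact: unflip1_hexnorms.
by case: ifP => // p [<-]; rewrite scale_unflip2; exact: unflip2_hexnorms.
Qed.

Lemma nextB_convex k v w z : one4_quad v -> nextB k v = Some w -> nextB k w = Some z ->
  all (fun m => (m (scale k v) <=? m (scale k w)) ==> (m (scale k w) <=? m (scale k z)))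
    hexnorms.
Proof.
move=> ov; have ou := one4_scale k ov; rewrite {1}/nextB.
case: ifP => [p [<-]|_].
  rewrite /nextB scale_flip0 leaves0_flip // p /=.
  have := flip0_convex ou; rewrite /= !andbT => /and3P[/andP[a1 a2] /andP[b1 b2] /andP[c1 c2]].
  case: ifP => _; first by move=> [<-]; rewrite scale_unflip1 scale_flip0 a1 b1 c1.
  by case: ifP => // _ [<-]; rewrite scale_unflip2 scale_flip0 a2 b2 c2.
have or1 := one4_rot ou; have or2 := one4_rot or1.
case: ifP => [p [<-]|_].
  rewrite /nextB scale_unflip1 {3}/unflip1 rot3 leaves0_flip // p /=.
  have := flip0_convex or1; rewrite /= !andbT => /and3P[/andP[a1 a2] /andP[b1 b2] /andP[c1 c2]].
  case: ifP => _.
    move=> [<-]; rewrite scale_flip0 scale_unflip1.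
    by move: a2 b2 c2; rewrite /unflip2 /unflip1 !rot3 => -> -> ->.
  case: ifP => // _ [<-]; rewrite scale_unflip2 scale_unflip1.
  by move: a1 b1 c1; rewrite /unflip2 /unflip1 !rot3 => -> -> ->.
case: ifP => // p [<-].
rewrite /nextB scale_unflip2 {5 6}/unflip2 rot3 rot3 leaves0_flip // p /=.
have := flip0_convex or2; rewrite /= !andbT => /and3P[/andP[a1 a2] /andP[b1 b2] /andP[c1 c2]].
case: ifP => _.
  move=> [<-]; rewrite scale_flip0 scale_unflip2.
  by move: a1 b1 c1; rewrite /unflip2 /unflip1 !rot3 => -> -> ->.
case: ifP => // _ [<-]; rewrite scale_unflip1 scale_unflip2.
by move: a2 b2 c2; rewrite /unflip2 /unflip1 !rot3 => -> -> ->.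
Qed.

(** For every k the same forest is oriented, so all k give equally many
    sinks. *)
Lemma oriented_nextB N k : oriented_by (fun v => onB N v) adjB (nextB k).
Proof.
split.
- by move=> v w _; exact: nextB_adj.
- by move=> v w /andP[ov _]; exact: nextB_oriented.
apply: (drains_exists (ms := [seq (fun v => Z.to_nat (m (scale k v))) | m <- hexnorms])).
- by move=> v w onv /nextB_adj; exact: onB_adj.
- move=> v w /andP[ov _] /(nextB_decreases ov).
  rewrite /= !orbF => /or3P[] /Z.ltb_spec0 h; apply/or3P; [apply: Or31 | apply: Or32 | apply: Or33].
  + by have := @hexnorm_ge0 (scale k w); lia.
  + by have := @hexnorm_ge0 (rot (scale k w)); lia.
  + by have := @hexnorm_ge0 (rot (rot (scale k w))); lia.
move=> v w z /andP[ov _] vw wz; have := nextB_convex ov vw wz.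
rewrite all_map; apply: sub_all => m /=; lia.
Qed.

Lemma nextB_sink k v : one4_quad v -> (nextB k v == None) = same3 (scale k v).
Proof.
move=> ov; have ou := one4_scale k ov; rewrite /nextB.
have := leaves_total ou; have := @same3_leaves0 (scale k v).
have := @same3_leaves0 (rot (scale k v)); have := @same3_leaves0 (rot (rot (scale k v))).
have -> : same3 (rot (scale k v)) = same3 (scale k v).
  by move: (scale k v) => [s [[x y] z]]; rewrite /same3 /rot; split_signs.
have -> : same3 (rot (rot (scale k v))) = same3 (scale k v).
  by move: (scale k v) => [s [[x y] z]]; rewrite /same3 /rot; split_signs.
case: same3 => [-> // -> // -> //|_ _ _ /=].
by case: (leaves0 _) => //; case: (leaves0 _) => //; case: (leaves0 _).
Qed.

Definition divpairs (M : Z) : seq (Z * Z) :=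
  [seq v <- zbox2 M | [&& 0 <? v.1, 0 <? v.2 & v.1 * v.2 == M]].

Definition sigma (M : Z) : nat := (\sum_(v <- divpairs M) Z.to_nat v.1)%N.

Lemma enumerates_divpairs M :
  enumerates (fun v : Z * Z => [&& 0 <? v.1, 0 <? v.2 & v.1 * v.2 == M]) (divpairs M).
Proof.
split; first by apply/filter_uniq/allpairs_uniq; rewrite ?zrange_uniq // => -[? ?] [? ?].
move=> [d e]; rewrite mem_filter; case: (boolP [&& _, _ & _]) => //= /and3P[/Z.ltb_spec0 d0 /Z.ltb_spec0 e0 /eqP de].
apply/allpairsP; exists (d, e); rewrite !mem_zrange /=; split=> //; apply/andP; split; apply/Z.leb_spec0; Lia.nia.
Qed.

Lemma one4_neq0 x : one4 x -> x <> 0.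
Proof. by move=> /one4E[k ->]; Lia.lia. Qed.

Lemma same_mul_gt0 x y : x <> 0 -> y <> 0 -> same x y -> 0 < x * y.
Proof. by split_signs => // ? ? _; Lia.nia. Qed.

Lemma same3_mul_gt0 s x y z : one4_quad (s, (x, y, z)) -> same3 (s, (x, y, z)) ->
  [/\ 0 < x * y, 0 < y * z & 0 < z * x].
Proof.
move=> /and4P[_ /one4_neq0 x0 /one4_neq0 y0 /one4_neq0 z0] /andP[xy yz].
by split; apply: same_mul_gt0 => //; move: xy yz; rewrite /same => /eqP-> /eqP->.
Qed.

Lemma same3_disc_gt0 v : same3 v -> one4_quad v -> 0 < disc v.
Proof.
move: v => [s [[x y] z]] s3 /same3_mul_gt0/(_ s3)[]; rewrite /disc /sym2.
by have := Z.square_nonneg s; Lia.lia.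
Qed.

Lemma disc_scale k v : disc (scale k v) = (2 * k + 1) * disc v.
Proof. by move: v => [s [[x y] z]]; rewrite /disc /scale /sym2; ring. Qed.

(** The lower left entry y - s of the matrix vanishes. After stretching by K =
    2 k + 1 the antisymmetric part and one of the parameters x, y are bounded
    by K, so |s - y| < 2 or |s + x| < 2. Now s - y is divisible by 4, and s +
    x is congruent to 2 modulo 4, which rules out the second case. *)
Lemma root_axis M k s x y z : 0 < M -> 4 * M < 2 * k + 1 ->
  one4_quad (s, (x, y, z)) -> disc (s, (x, y, z)) = 4 * M ->
  same3 (scale k (s, (x, y, z))) -> s = y.
Proof.
move=> M0 kM ov dv s3.
have := disc_scale k (s, (x, y, z)); rewrite dv.
have := same3_mul_gt0 (one4_scale k ov) s3.
have sy : (s + k * (s - y)) - (y - k * (s - y)) = (2 * k + 1) * (s - y) by ring.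
have xy : (x + 2 * k * (x + y) + k * (s - y)) + (s + k * (s - y)) = (2 * k + 1) * (s + x) by ring.
rewrite /disc /sym2 /scale; move: sy xy; set K := 2 * k + 1 in kM *.
move: (s + _) (x + _ + _) (y - _) (z + _) => S X Y W sy xy [XY YW WX] eq.
move: ov => /and4P[/one4E[s' es] /one4E[x' ex] /one4E[y' ey] _].
have SK : S * S < K * K.
  have := Z.mul_lt_mono_pos_l K (4 * M) K; Lia.lia.
have SK' : - K < S < K.
  by split; apply/Z.nle_gt => h; have := Z.mul_le_mono_nonneg K (Z.abs S) K (Z.abs S); Lia.lia.
have small t c : - c * K < K * t < c * K -> - c < t < c.
  by move=> [h1 h2]; split; apply: (@Zmult_lt_reg_r _ _ K); Lia.lia.
have [YK|YK] : (- K <= Y <= K) \/ (K < Z.abs Y) by Lia.lia.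
  have := small (s - y) 2; Lia.lia.
have XK : - K < X < K.
  have aXY : Z.abs X * Z.abs Y = X * Y by rewrite -Z.abs_mul Z.abs_eq; Lia.lia.
  have : Z.abs X * Z.abs Y < K * K.
    have := Z.mul_lt_mono_pos_l K (4 * M) K; have := Z.square_nonneg S; Lia.lia.
  move=> h; suff : Z.abs X < K by Lia.lia.
  by apply/Z.nle_gt => h'; have := Z.mul_le_mono_nonneg K (Z.abs X) K (Z.abs Y); Lia.lia.
have := small (s + x) 2; Lia.lia.
Qed.

Definition naturals (n : Z) : seq Z := [seq Z.of_nat j | j <- iota 0 (Z.to_nat n)].

Lemma enumerates_naturals n : enumerates (fun j => (0 <=? j) && (j <? n)) (naturals n).
Proof.
split; first by rewrite map_inj_uniq ?iota_uniq // => i j; lia.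
move=> j; apply/mapP/idP => [[i]|/andP[/Z.leb_spec0 j0 /Z.ltb_spec0 jn]].
  by rewrite mem_iota => h ->; apply/andP; split; [apply/Z.leb_spec0|apply/Z.ltb_spec0]; lia.
by exists (Z.to_nat j); rewrite ?mem_iota; lia.
Qed.

Lemma size_naturals n : size (naturals n) = Z.to_nat n.
Proof. by rewrite size_map size_iota. Qed.

(** Hermite normal forms of determinant M: two diagonal entries c and a, and a
    residue j modulo c. *)
Definition sigma_triple (M : Z) (t : Z * Z * Z) : bool :=
  let: (c, a, j) := t in
  [&& 0 <? c, 0 <? a, c * a == M, 0 <=? j & j <? c].

Lemma sigma_triples M : exists l, enumerates (sigma_triple M) l /\ size l = sigma M.
Proof.
exists [seq (p, j) | p <- divpairs M, j <- naturals p.1]; split.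
  apply: enumerates_fibers; first by have [] := enumerates_divpairs M.
    by move=> [c a] j /and5P[c0 a0 ca _ _]; have [_ ->] := enumerates_divpairs M; apply/and3P.
  move=> [c a]; have [_ ->] := enumerates_divpairs M => /and3P[/= c0 a0 ca].
  have [u m] := enumerates_naturals c; split=> // j.
  by rewrite m /= c0 a0 ca.
rewrite size_allpairs_dep sumnE big_map /sigma.
by apply: eq_bigr => -[c a] _; rewrite size_naturals.
Qed.

(** Twice a Hermite normal form. Its off-diagonal residue modulo 4 c has the
    representatives 4 j + 1 and 4 j + 1 - 4 c; the first is taken when y and z
    are then both positive, the second, with the opposite diagonal, when both
    are negative. *)
Definition root_of (t : Z * Z * Z) : quad :=
  let: (c, a, j) := t in
  let v := 4 * j + 1 in
  if v <? 2 * c then (v, (2 * a - v, v, 2 * c - v))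
  else let w := v - 4 * c in (w, (- 2 * a - w, w, - 2 * c - w)).

Definition of_root (r : quad) : Z * Z * Z :=
  let: (s, (x, y, z)) := r in
  if 0 <? y then ((y + z) / 2, (x + y) / 2, y / 4)
  else (- ((y + z) / 2), - ((x + y) / 2), (y - 2 * (y + z)) / 4).

Lemma div_unique_exact a b q r : 0 <= r < b -> a = b * q + r -> a / b = q.
Proof. by move=> h e; symmetry; apply: (Z.div_unique_pos _ _ _ r). Qed.

Lemma odd_factors c a M : c * a = M -> Z.odd M -> Z.odd c && Z.odd a.
Proof. by move=> <-; rewrite Z.odd_mul. Qed.

Lemma root_ofP M t : Z.odd M -> sigma_triple M t ->
  (onB (4 * M) (root_of t) && same3 (scale (2 * M) (root_of t))) /\ of_root (root_of t) = t.
Proof.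
move: t => [[c a] j] oM /and5P[/Z.ltb_spec0 c0 /Z.ltb_spec0 a0 /eqP ca /Z.leb_spec0 j0 /Z.ltb_spec0 jc].
have /andP[/Z.odd_spec[c' ec] /Z.odd_spec[a' ea]] := odd_factors ca oM.
have cM : c <= M by Lia.nia.
have aM : M <= M * a by Lia.nia.
rewrite /root_of; case: Z.ltb_spec => h.
  split.
    apply/andP; split; [apply/andP; split|].
    - apply/and4P; split; rewrite ?one4I //.
        by apply: (@one4_is _ (a' - j)); Lia.lia.
      by apply: (@one4_is _ (c' - j)); Lia.lia.
    - by apply/orP; left; apply/Z.eqb_spec; rewrite /disc /sym2 -ca; ring.
    by rewrite /same3 /scale; split_signs.
  rewrite /of_root; case: Z.ltb_spec => h'; last by exfalso; Lia.lia.
  congr (_, _, _); [apply: (@div_unique_exact _ _ _ 0)|apply: (@div_unique_exact _ _ _ 0)|apply: (@div_unique_exact _ _ _ 1)]; Lia.lia.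
split.
  apply/andP; split; [apply/andP; split|].
  - apply/and4P; split.
    + by apply: (@one4_is _ (j - c)); Lia.lia.
    + by apply: (@one4_is _ (c - a' - j - 1)); Lia.lia.
    + by apply: (@one4_is _ (j - c)); Lia.lia.
    + by apply: (@one4_is _ (c - c' - j - 1)); Lia.lia.
  - by apply/orP; left; apply/Z.eqb_spec; rewrite /disc /sym2 -ca; ring.
  by rewrite /same3 /scale; split_signs.
rewrite /of_root; case: Z.ltb_spec => h'; first by exfalso; Lia.lia.
congr (_, _, _); [rewrite (@div_unique_exact _ _ (- c) 0)|rewrite (@div_unique_exact _ _ (- a) 0)|apply: (@div_unique_exact _ _ _ 1)]; Lia.lia.
Qed.

Lemma of_rootP M r : 0 < M ->
  onB (4 * M) r && same3 (scale (2 * M) r) ->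
  sigma_triple M (of_root r) /\ root_of (of_root r) = r.
Proof.
move: r => [s [[x y] z]] M0 /andP[/andP[ov dv] s3].
have dd : disc (s, (x, y, z)) = 4 * M.
  have := same3_disc_gt0 s3 (one4_scale _ ov); rewrite disc_scale.
  by case/orP: dv => /eqP -> //; Lia.nia.
have sy : s = y by apply: (root_axis M0 _ ov dd s3); Lia.lia.
move: ov dd s3; rewrite sy => ov.
have /and4P[_ /one4E[x' ex] /one4E[y' ey] /one4E[z' ez]] := ov.
rewrite /disc /sym2 => dd; have ca : ((y + z) / 2) * ((x + y) / 2) = M.
  by rewrite (@div_unique_exact (y + z) 2 (2 * y' + 2 * z' + 1) 0) ?(@div_unique_exact (x + y) 2 (2 * x' + 2 * y' + 1) 0); Lia.lia.
have ec : (y + z) / 2 = 2 * y' + 2 * z' + 1 by apply: (@div_unique_exact _ _ _ 0); Lia.lia.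
have ea : (x + y) / 2 = 2 * x' + 2 * y' + 1 by apply: (@div_unique_exact _ _ _ 0); Lia.lia.
rewrite ec ea in ca.
have e1 : x + 2 * (2 * M) * (x + y) + 2 * M * (y - y) =
  2 * (2 * M) * (2 * (2 * x' + 2 * y' + 1)) + x by rewrite ex ey; ring.
rewrite /same3 /scale e1 Z.sub_diag Z.mul_0_r Z.sub_0_r Z.add_0_r => /andP[s3 s3'].
have XY := same_mul_gt0 (one4_neq0 (one4_is ey)) (one4_neq0 (one4_is ez)) s3'.
rewrite /of_root ec ea; case: Z.ltb_spec => y0; rewrite /sigma_triple /root_of.
  have z0 : 0 < z by clear -XY y0; Lia.nia.
  have c0 : 0 < 2 * y' + 2 * z' + 1 by Lia.lia.
  have a0 : 0 < 2 * x' + 2 * y' + 1 by clear -ca c0 M0; Lia.nia.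
  have -> : y / 4 = y' by apply: (@div_unique_exact _ _ _ 1); Lia.lia.
  split.
    by apply/and5P; split; [apply/Z.ltb_spec0|apply/Z.ltb_spec0|apply/eqP|apply/Z.leb_spec0|apply/Z.ltb_spec0]; Lia.lia.
  by case: Z.ltb_spec => ?; [congr (_, (_, _, _))|exfalso]; Lia.lia.
have z0 : z < 0 by clear -XY y0; Lia.nia.
have c0 : 2 * y' + 2 * z' + 1 < 0 by Lia.lia.
have a0 : 2 * x' + 2 * y' + 1 < 0 by clear -ca c0 M0; Lia.nia.
have -> : (y - 2 * (y + z)) / 4 = - y' - 2 * z' - 1 by apply: (@div_unique_exact _ _ _ 1); Lia.lia.
split.
  by apply/and5P; split; [apply/Z.ltb_spec0|apply/Z.ltb_spec0|apply/eqP|apply/Z.leb_spec0|apply/Z.ltb_spec0]; Lia.lia.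
by case: Z.ltb_spec => ?; [exfalso|congr (_, (_, _, _))]; Lia.lia.
Qed.

(** A class number relation: pairs (s, reduced form of determinant 4 M - s^2)
    are the sinks of the unstretched orientation, and the sinks after a large
    stretching are counted by sigma M. *)
Lemma size_sinksB M l : 0 < M -> Z.odd M ->
  enumerates (fun v => [&& one4_quad v, same3 v & disc v == 4 * M]) l -> size l = sigma M.
Proof.
move=> M0 oM el; have [m [em <-]] := sigma_triples M.
have er : enumerates (fun r => onB (4 * M) r && same3 (scale (2 * M) r)) (map root_of m).
  apply: (enumerates_map (g := of_root) em) => [t|r]; first exact: root_ofP.
  exact: of_rootP.
rewrite -(size_map root_of m).
apply: (size_sinks (V := onB (4 * M)) (onB_adj (N := 4 * M)) (oriented_nextB _ 0) (oriented_nextB _ (2 * M))).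
  case: el => ul ml; split=> // v; rewrite ml /onB.
  have id0 : scale 0 v = v by move: v => [s [[x y] z]]; rewrite /scale; congr (_, (_, _, _)); ring.
  case: (boolP (one4_quad v)) => //= ov; rewrite nextB_sink // id0.
  case: (boolP (same3 v)) => s3; rewrite ?andbT ?andbF //.
  have dp := same3_disc_gt0 s3 ov.
  have -> : (disc v == - (4 * M)) = false by apply/Z.eqb_neq; Lia.lia.
  by rewrite orbF.
case: er => ur mr; split=> // v; rewrite mr /onB.
by case: (boolP (one4_quad v)) => //= ov; rewrite nextB_sink.
Qed.

(** * Sums of four odd squares *)

Definition triple : Type := (Z * Z * Z)%type.
Definition quint : Type := (Z * quad)%type.

Definition norm3 (w : triple) : Z := let: (x, y, z) := w in x * x + y * y + z * z.
Definition norm4 (v : quad) : Z := let: (s, w) := v in s * s + norm3 w.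
Definition norm5 (v : quint) : Z := let: (t, w) := v in t * t + norm4 w.

Definition one4_triple (w : triple) : bool :=
  let: (x, y, z) := w in [&& one4 x, one4 y & one4 z].

Definition reps4 (n : Z) : seq quad :=
  [seq v <- [seq (s, w) | s <- zrange n, w <- zbox3 n] | one4_quad v && (norm4 v == n)].

Lemma zbox3_uniq B : uniq (zbox3 B).
Proof.
by rewrite !allpairs_uniq ?zrange_uniq //; [move=> [? ?] [? ?] | move=> [? ?] [? ?]].
Qed.

Lemma mem_zbox3 B x y z :
  ((x, y, z) \in zbox3 B) = [&& x \in zrange B, y \in zrange B & z \in zrange B].
Proof.
apply/allpairsP/and3P => [[[p c] /= [/allpairsP[[a b] /= [aB bB ->]] cB [-> -> ->]]] //|[xB yB zB]].
by exists ((x, y), z); split=> //; apply/allpairsP; exists (x, y).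
Qed.

Lemma zrange_sq (x n : Z) : x * x <= n -> x \in zrange n.
Proof. by rewrite mem_zrange => h; apply/andP; split; apply/Z.leb_spec0; Lia.nia. Qed.

Lemma zrange_norm3 x y z n : x * x + y * y + z * z <= n ->
  [/\ x \in zrange n, y \in zrange n & z \in zrange n].
Proof.
have := Z.square_nonneg x; have := Z.square_nonneg y; have := Z.square_nonneg z.
by move=> ? ? ? ?; split; apply: zrange_sq; Lia.lia.
Qed.

Lemma enumerates_reps4 n :
  enumerates (fun v => one4_quad v && (norm4 v == n)) (reps4 n).
Proof.
split.
  rewrite filter_uniq // allpairs_uniq ?zrange_uniq ?zbox3_uniq //.
  by move=> [? ?] [? ?].
move=> [s [[x y] z]]; rewrite mem_filter; case: (boolP (one4_quad _ && _)) => [/andP[_ /Z.eqb_eq nv]|//].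
have s0 := Z.square_nonneg s; move: nv; rewrite /norm4 /norm3 => nv.
have [|xB yB zB] := @zrange_norm3 x y z n; first Lia.lia.
apply/allpairsP; exists (s, (x, y, z)); rewrite mem_zbox3 xB yB zB; split=> //=.
have := Z.square_nonneg x; have := Z.square_nonneg y; have := Z.square_nonneg z.
by move=> ? ? ?; apply: zrange_sq; Lia.lia.
Qed.

Definition one4s (n : Z) : seq Z := [seq s <- zrange n | one4 s].

Lemma one4s_uniq n : uniq (one4s n).
Proof. by rewrite filter_uniq ?zrange_uniq. Qed.

Lemma mem_one4s n s : (s \in one4s n) = one4 s && (s \in zrange n).
Proof. by rewrite mem_filter. Qed.

Definition one4_quint (v : quint) : bool := one4 v.1 && one4_quad v.2.

Definition swap1 (v : quint) : quint := let: (t, (s, w)) := v in (s, (t, w)).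
Definition swap2 (v : quint) : quint := let: (t, (s, (x, y, z))) := v in (x, (s, (t, y, z))).
Definition swap3 (v : quint) : quint := let: (t, (s, (x, y, z))) := v in (y, (s, (x, t, z))).
Definition swap4 (v : quint) : quint := let: (t, (s, (x, y, z))) := v in (z, (s, (x, y, t))).

Lemma sum_swap n l (f : quint -> quint) (F : quint -> Z) :
  enumerates (fun v => one4_quint v && (norm5 v == n)) l ->
  (forall v, one4_quint (f v) = one4_quint v) -> (forall v, norm5 (f v) = norm5 v) ->
  (forall v, f (f v) = v) -> (\sum_(v <- l) F (f v) = \sum_(v <- l) F v)%R.
Proof.
move=> el fo fn ff; rewrite (sum_enumerates_bij (g := f) (f := f) F el el) // => v.
  by rewrite fo fn ff.
by rewrite fo fn ff.
Qed.

(** By symmetry all five coordinates have the same mean square n / 5. *)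
Lemma reps5_balance n l :
  enumerates (fun v => one4_quint v && (norm5 v == n)) l ->
  (\sum_(v <- l) (n - 5 * (v.1 * v.1))%ZZ = 0)%R.
Proof.
move=> el.
pose S (i : quint -> quint) : Z := (\sum_(v <- l) ((i v).1 * (i v).1)%ZZ)%R.
have S1 : S swap1 = S id.
  apply: (sum_swap (fun v => v.1 * v.1) el) => [[t [s w]]|[t [s [[x y] z]]]|[t [s w]]] //.
    by rewrite /one4_quint /one4_quad /=; case: w => [[x y] z]; rewrite andbCA.
  by rewrite /swap1 /norm5 /norm4; ring.
have S2 : S swap2 = S id.
  apply: (sum_swap (fun v => v.1 * v.1) el) => [[t [s [[x y] z]]]|[t [s [[x y] z]]]|[t [s [[x y] z]]]] //.
    by rewrite /one4_quint /one4_quad /=; do 5 case: (one4 _).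
  by rewrite /swap2 /norm5 /norm4 /norm3; ring.
have S3 : S swap3 = S id.
  apply: (sum_swap (fun v => v.1 * v.1) el) => [[t [s [[x y] z]]]|[t [s [[x y] z]]]|[t [s [[x y] z]]]] //.
    by rewrite /one4_quint /one4_quad /=; do 5 case: (one4 _).
  by rewrite /swap3 /norm5 /norm4 /norm3; ring.
have S4 : S swap4 = S id.
  apply: (sum_swap (fun v => v.1 * v.1) el) => [[t [s [[x y] z]]]|[t [s [[x y] z]]]|[t [s [[x y] z]]]] //.
    by rewrite /one4_quint /one4_quad /=; do 5 case: (one4 _).
  by rewrite /swap4 /norm5 /norm4 /norm3; ring.
have balance t s x y z : t * t + (s * s + (x * x + y * y + z * z)) - 5 * (t * t) =
    s * s - t * t + (x * x - t * t) + (y * y - t * t) + (z * z - t * t) by ring.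
have -> : (\sum_(v <- l) (n - 5 * (v.1 * v.1))%ZZ =
   (S swap1 - S id) + (S swap2 - S id) + (S swap3 - S id) + (S swap4 - S id))%R.
  rewrite -!sumrB -!big_split [LHS]big_seq [RHS]big_seq /=.
  case: el => _ ml; apply: eq_bigr => -[t [s [[x y] z]]]; rewrite ml => /andP[_ /Z.eqb_eq <-].
  rewrite /swap1 /swap2 /swap3 /swap4 /norm5 /norm4 /norm3 /=.
  exact: balance.
by rewrite S1 S2 S3 S4 subrr !addr0.
Qed.

Definition windmill (n : Z) (v : Z * (Z * Z)) : bool :=
  let: (s, (d, e)) := v in [&& Z.odd s, 0 <? d, 0 <? e & s * s + 4 * (d * e) == n].

Lemma windmillP n s d e :
  reflect [/\ Z.odd s, 0 < d, 0 < e & s * s + 4 * (d * e) = n] (windmill n (s, (d, e))).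
Proof.
apply: (iffP and4P) => -[os d0 e0 h]; split=> //; try exact/Z.ltb_spec0; exact/Z.eqb_spec.
Qed.

Lemma odd_sq_mod8 s : Z.odd s -> exists k, s * s = 8 * k + 1.
Proof.
move=> /Z.odd_spec[m ->].
have [[j ->]|[j ->]] := Z.Even_or_Odd m.
- by exists (2 * j * j + j); ring.
- by exists (2 * j * j + 3 * j + 1); ring.
Qed.

Lemma windmill_wall n s d e : n mod 8 = 5 -> windmill n (s, (d, e)) -> e - d <> s.
Proof.
move=> n5 /windmillP[os _ _ h] ed.
have [|k hk] := @odd_sq_mod8 (s + 2 * d); first by rewrite Z.odd_add_mul_2.
have en : n = k * 8 + 1 by rewrite -h -[RHS]Z.add_comm; Lia.nia.
by move: n5; rewrite en Z.add_comm Z_mod_plus_full.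
Qed.

Lemma eqN0 (x : Z) : x = (- x)%R -> x = 0.
Proof. by change (x = - x -> x = 0); Lia.lia. Qed.

(** The method of Liouville and Zagier: the set is cut by the wall e - d = s
    into two halves exchanged by the involution cross, while the involution
    mill preserves one half. Up to a part odd in s, the sum of the summand and
    of its image under cross is a function that changes sign under mill. *)
Lemma windmill_balance n l : n mod 8 = 5 -> enumerates (windmill n) l ->
  (\sum_(v <- l) (v.2.1 * (v.2.1 * v.2.2 - v.1 * v.1))%ZZ = 0)%R.
Proof.
move=> n5 el.
pose neg (v : Z * (Z * Z)) := (- v.1, v.2).
pose cross (v : Z * (Z * Z)) := (- v.1, (v.2.2, v.2.1)).
pose mill (v : Z * (Z * Z)) := (- v.1 - 2 * v.2.1, (v.2.1, v.2.2 - v.1 - v.2.1)).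
pose right (v : Z * (Z * Z)) := v.1 <? v.2.2 - v.2.1.
have reflP v : windmill n v -> windmill n (neg v) /\ neg (neg v) = v.
  move: v => [s [d e]] /windmillP[os d0 e0 h]; split.
    by apply/windmillP; split; rewrite /fst /snd ?Z.odd_opp // -h; ring.
  by rewrite /neg /= Z.opp_involutive.
(* The part of the summand that is odd in s. *)
have odd_part : (\sum_(v <- l) (v.1 * v.2.1 * v.2.1)%ZZ = 0)%R.
  apply: eqN0; rewrite -[RHS]sumrN {1}(sum_enumerates_bij (fun v => v.1 * v.2.1 * v.2.1) el el reflP reflP).
  apply: eq_bigr => -[s [d e]] _; rewrite /neg /=.
  by change (- s * d * d = - (s * d * d)); ring.
have eR : enumerates (fun v => windmill n v && right v) [seq v <- l | windmill n v && right v].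
  by apply: enumerates_filter el _ => v /andP[].
have eL : enumerates (fun v => windmill n v && ~~ right v) [seq v <- l | windmill n v && ~~ right v].
  by apply: enumerates_filter el _ => v /andP[].
have millP v : windmill n v && right v -> (windmill n (mill v) && right (mill v)) /\ mill (mill v) = v.
  move: v => [s [d e]] /andP[/windmillP[os d0 e0 h] /Z.ltb_spec0 r]; rewrite /fst /snd in r; split; last first.
    by rewrite /mill /fst /snd; congr (_, (_, _)); ring.
  apply/andP; split; last by apply/Z.ltb_spec0; rewrite /right ?/mill ?/cross /fst /snd; Lia.lia.
  apply/windmillP; rewrite /mill /fst /snd; split; [|Lia.lia|Lia.lia|rewrite -h; ring].
  by rewrite -Z.add_opp_r -Z.mul_opp_r Z.odd_add_mul_2 Z.odd_opp.
have crossP v : windmill n v && right v ->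
    (windmill n (cross v) && ~~ right (cross v)) /\ cross (cross v) = v.
  move: v => [s [d e]] /andP[/windmillP[os d0 e0 h] /Z.ltb_spec0 r]; rewrite /fst /snd in r; split; last first.
    by rewrite /cross /fst /snd; congr (_, (_, _)); ring.
  apply/andP; split; last by apply/negP => /Z.ltb_spec0; rewrite ?/cross /fst /snd; Lia.lia.
  by apply/windmillP; split; rewrite /fst /snd ?Z.odd_opp // -h; ring.
have crossP' v : windmill n v && ~~ right v ->
    (windmill n (cross v) && right (cross v)) /\ cross (cross v) = v.
  move: v => [s [d e]] /andP[w /Z.ltb_spec0 r]; rewrite /fst /snd in r; split; last first.
    by rewrite /cross /fst /snd; congr (_, (_, _)); ring.
  have /windmillP[os d0 e0 h] := w; have := windmill_wall n5 w => wall.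
  apply/andP; split; last by apply/Z.ltb_spec0; rewrite /right ?/mill ?/cross /fst /snd; Lia.lia.
  by apply/windmillP; split; rewrite /fst /snd ?Z.odd_opp // -h; ring.
pose g (v : Z * (Z * Z)) := v.2.1 * (v.2.1 * v.2.2 - v.1 * v.1) - v.1 * v.2.1 * v.2.1.
pose H (v : Z * (Z * Z)) := (v.2.1 + v.2.2) * (v.2.1 + v.1) * (v.2.2 - v.1).
(* H changes sign under mill. *)
have H0 : (\sum_(v <- l | right v) H v = 0)%R.
  have -> : (\sum_(v <- l | right v) H v = \sum_(v <- [seq v <- l | windmill n v && right v]) H v)%R.
    rewrite big_filter big_seq_cond [RHS]big_seq_cond; apply: eq_bigl => v.
    by case: el => _ ->; rewrite andbA andbb.
  apply: eqN0; rewrite -[RHS]sumrN {1}(sum_enumerates_bij H eR eR millP millP).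
  apply: eq_bigr => -[s [d e]] _; rewrite /mill /H /=.
  by change ((d + (e - s - d)) * (d + (- s - 2 * d)) * (e - s - d - (- s - 2 * d)) =
     - ((d + e) * (d + s) * (e - s))); ring.
have G0 : (\sum_(v <- l) g v = 0)%R.
  rewrite (bigID right) /= -[RHS]H0.
  have -> : (\sum_(v <- l | ~~ right v) g v = \sum_(v <- l | right v) g (cross v))%R.
    have -> : (\sum_(v <- l | ~~ right v) g v = \sum_(v <- [seq v <- l | windmill n v && ~~ right v]) g v)%R.
      rewrite big_filter big_seq_cond [RHS]big_seq_cond; apply: eq_bigl => v.
      by case: el => _ ->; rewrite andbA andbb.
    rewrite (sum_enumerates_bij g eR eL crossP crossP') big_filter.
    rewrite big_seq_cond [RHS]big_seq_cond; apply: eq_bigl => v.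
    by case: el => _ ->; rewrite andbA andbb.
  rewrite -big_split; apply: eq_bigr => -[s [d e]] _; rewrite /g /cross /H /=.
  by change (d * (d * e - s * s) - s * d * d + (e * (e * d - - s * - s) - - s * e * e) =
    (d + e) * (d + s) * (e - s)); ring.
have -> : (\sum_(v <- l) (v.2.1 * (v.2.1 * v.2.2 - v.1 * v.1))%ZZ =
   \sum_(v <- l) g v + \sum_(v <- l) (v.1 * v.2.1 * v.2.1)%ZZ)%R.
  rewrite -big_split; apply: eq_bigr => -[s [d e]] _; rewrite /g /=.
  by change (d * (d * e - s * s) = d * (d * e - s * s) - s * d * d + s * d * d); ring.
by rewrite G0 odd_part addr0.
Qed.

Lemma sum_constZ (T : Type) (l : seq T) (c : Z) :
  (\sum_(q <- l) c = c * Z.of_nat (size l))%ZZ%R.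
Proof.
elim: l => [|x l IH]; first by rewrite big_nil Z.mul_0_r.
rewrite big_cons IH -[size (x :: l)]/(size l).+1 Nat2Z.inj_succ; change (c + c * Z.of_nat (size l) = c * Z.succ (Z.of_nat (size l))).
by ring.
Qed.

Lemma quarter n s : n mod 8 = 5 -> Z.odd s ->
  exists q, [/\ n - s * s = 4 * q, (n - s * s) / 4 = q & Z.odd q].
Proof.
move=> n5 /odd_sq_mod8[k ek]; have en := Z.div_mod n 8; rewrite n5 in en.
exists (2 * (n / 8) - 2 * k + 1); split; first by Lia.lia.
  by apply: (@div_unique_exact _ _ _ 0); Lia.lia.
by rewrite (_ : _ + 1 = 1 + 2 * (n / 8 - k)) ?Z.odd_add_mul_2 //; ring.
Qed.

Lemma one4_odd s : one4 s -> Z.odd s.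
Proof. by move=> /one4E[k ->]; rewrite (_ : 4 * k + 1 = 1 + 2 * (2 * k)) ?Z.odd_add_mul_2 //; ring. Qed.

Lemma one4_opp s : Z.odd s -> one4 (- s) = ~~ one4 s.
Proof.
move=> /Z.odd_spec[m ->]; have [[j ->]|[j ->]] := Z.Even_or_Odd m.
  rewrite (@one4_is (2 * (2 * j) + 1) j); last by Lia.lia.
  by apply/negbTE/negP => /one4E[k]; Lia.lia.
rewrite (@one4_is _ (- j - 1)); last by Lia.lia.
by symmetry; apply/negP => /one4E[k]; Lia.lia.
Qed.

Lemma zrange_opp n s : (- s \in zrange n) = (s \in zrange n).
Proof. by rewrite !mem_zrange; apply/idP/idP => /andP[/Z.leb_spec0 ? /Z.leb_spec0 ?]; apply/andP; split; apply/Z.leb_spec0; Lia.lia. Qed.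

Lemma sigma_sum M : Z.of_nat (sigma M) = (\sum_(w <- divpairs M) w.1)%R.
Proof.
rewrite /sigma (big_morph Z.of_nat Nat2Z.inj_add (erefl : Z.of_nat 0 = 0%R)).
rewrite big_seq [RHS]big_seq; apply: eq_bigr => w; have [_ ->] := enumerates_divpairs M.
by move=> /and3P[/Z.ltb_spec0 w0 _ _]; rewrite Z2Nat.id //; Lia.lia.
Qed.

(** The recursion of the divisor sum, obtained by grouping the solutions of
    s^2 + 4 d e = n by s. *)
Lemma sigma_balance n : n mod 8 = 5 ->
  (\sum_(s <- one4s n) ((n - 5 * (s * s)) * Z.of_nat (sigma ((n - s * s) / 4)))%ZZ = 0)%R.
Proof.
move=> n5; pose r := [seq s <- zrange n | Z.odd s].
have ur : uniq r by rewrite filter_uniq ?zrange_uniq.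
have mr s : (s \in r) = Z.odd s && (s \in zrange n) by rewrite mem_filter.
pose l s := divpairs ((n - s * s) / 4).
have rl s : s \in r -> enumerates (fun w => windmill n (s, w)) (l s).
  rewrite mr => /andP[os _]; have [u m] := enumerates_divpairs ((n - s * s) / 4).
  split=> // -[d e]; rewrite m /windmill os /fst /snd andTb.
  have [q [h -> _]] := quarter n5 os.
  congr [&& _, _ & _]; apply/idP/idP => /Z.eqb_eq ?; apply/Z.eqb_spec; Lia.lia.
have wr s w : windmill n (s, w) -> s \in r.
  move: w => [d e] /windmillP[os d0 e0 h]; rewrite mr os; apply: zrange_sq.
  by have := Z.mul_pos_pos _ _ d0 e0; Lia.lia.
have eW := enumerates_fibers ur wr rl.
pose G s := (n - 5 * (s * s)) * Z.of_nat (sigma ((n - s * s) / 4)).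
have Gr : (\sum_(s <- r) G s = 0)%R.
  have := windmill_balance n5 eW.
  rewrite (sum_enumerates_fibers (fun s w => w.1 * (w.1 * w.2 - s * s)) eW ur wr rl) => h.
  have -> : (\sum_(s <- r) G s = 4 * \sum_(s <- r) \sum_(w <- l s) (w.1 * (w.1 * w.2 - s * s))%ZZ)%R.
    rewrite mulr_sumr big_seq [RHS]big_seq; apply: eq_bigr => s sr.
    have mulE a b : (a * b)%ZZ = (a * b)%R by [].
    rewrite /G sigma_sum mulE !mulr_sumr big_seq [RHS]big_seq; apply: eq_bigr => -[d e] del.
    have [_ /(_ (d, e))] := rl s sr; rewrite del => /esym /windmillP[_ d0 _ <-].
    by change ((s * s + 4 * (d * e) - 5 * (s * s)) * d = 4 * (d * (d * e - s * s))); ring.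
  by rewrite h mulr0.
have : (\sum_(s <- r) G s = \sum_(s <- one4s n) G s + \sum_(s <- one4s n) G s)%R.
  rewrite (bigID one4) /=; congr (_ + _)%R.
    rewrite -big_filter; apply: perm_big; apply: uniq_perm; rewrite ?filter_uniq ?zrange_uniq ?one4s_uniq //.
    move=> s; rewrite mem_filter mr mem_one4s; case: (boolP (one4 s)) => //= os.
    by rewrite one4_odd.
  have e1 : enumerates (fun s => one4 s && (s \in zrange n)) (one4s n).
    by split; [exact: one4s_uniq | move=> s; exact: mem_one4s].
  have e2 : enumerates (fun s => ~~ one4 s && (s \in r)) [seq s <- r | ~~ one4 s].
    by split; [rewrite filter_uniq | move=> s; rewrite mem_filter].
  rewrite -big_filter (sum_enumerates_bij (f := Z.opp) (g := Z.opp) G e1 e2).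
  - by apply: eq_bigr => s _; rewrite /G Z.mul_opp_opp.
  - move=> s /andP[os sn]; rewrite mr Z.odd_opp one4_odd // zrange_opp sn one4_opp ?one4_odd // os.
    by rewrite Z.opp_involutive.
  move=> s /andP[no]; rewrite mr => /andP[os sn]; rewrite one4_opp // no zrange_opp sn.
  by rewrite Z.opp_involutive.
by rewrite Gr; change (0 = Z.add (\sum_(s <- one4s n) G s)%R (\sum_(s <- one4s n) G s)%R -> (\sum_(s <- one4s n) G s)%R = 0); Lia.lia.
Qed.

(** The same recursion for representations by four squares, obtained by
    grouping representations by five squares by one coordinate. *)
Lemma reps_balance n :
  (\sum_(t <- one4s n) ((n - 5 * (t * t)) * Z.of_nat (size (reps4 (n - t * t))))%ZZ = 0)%R.
Proof.
have h1 t v : one4_quint (t, v) && (norm5 (t, v) == n) -> t \in one4s n.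
  move: v => [s [[x y] z]] /andP[/andP[/= ot _] /Z.eqb_eq nv].
  rewrite mem_one4s ot zrange_sq //; move: nv; rewrite /norm5 /norm4 /norm3.
  have := Z.square_nonneg s; have := Z.square_nonneg x.
  by have := Z.square_nonneg y; have := Z.square_nonneg z; Lia.lia.
have h2 t : t \in one4s n ->
    enumerates (fun v => one4_quint (t, v) && (norm5 (t, v) == n)) (reps4 (n - t * t)).
  rewrite mem_one4s => /andP[ot _].
  have [u m] := enumerates_reps4 (n - t * t); split=> // v; rewrite m /one4_quint ot /=.
  by congr andb; rewrite /norm5; apply/idP/idP => /Z.eqb_eq h; apply/Z.eqb_spec; Lia.lia.
have e5 := enumerates_fibers (P := fun v => one4_quint v && (norm5 v == n)) (one4s_uniq n) h1 h2.
have := reps5_balance e5.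
rewrite (sum_enumerates_fibers (P := fun v => one4_quint v && (norm5 v == n)) (fun t v => n - 5 * (t * t)) e5 (one4s_uniq n) h1 h2).
by under eq_bigr => t _ do rewrite sum_constZ.
Qed.

Lemma zdescent (P : Z -> Prop) :
  (forall M, (forall M', 0 <= M' < M -> P M') -> 0 <= M -> P M) -> forall M, 0 <= M -> P M.
Proof.
move=> step M M0; suff H k : forall M', 0 <= M' < Z.of_nat k -> P M'.
  by apply: (H (Z.to_nat M).+1); rewrite Nat2Z.inj_succ Z2Nat.id //; Lia.lia.
elim: k => [|k IH] M' h; first by exfalso; move: h => /=; Lia.lia.
by apply: step; [move=> M'' h'; apply: IH; lia | lia].
Qed.

Lemma divpairs_le0 M : M <= 0 -> divpairs M = [::].
Proof.
move=> M0; have [_ m] := enumerates_divpairs M; case e: (divpairs M) => [//|w l].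
have := m w; rewrite e mem_head => /esym /and3P[/Z.ltb_spec0 a /Z.ltb_spec0 b /Z.eqb_eq ab].
by exfalso; have := Z.mul_pos_pos _ _ a b; Lia.lia.
Qed.

Lemma reps4_le0 n : n <= 0 -> reps4 n = [::].
Proof.
move=> n0; have [_ m] := enumerates_reps4 n; case e: (reps4 n) => [//|[s [[x y] z]] l].
have := m (s, (x, y, z)); rewrite e mem_head => /esym /andP[/and4P[/one4_neq0 s0 _ _ _] /Z.eqb_eq].
rewrite /norm4 /norm3; have := Z.square_nonneg x.
by have := Z.square_nonneg y; have := Z.square_nonneg z; Lia.nia.
Qed.

(** Both sides satisfy the same linear recursion: the terms of n = 4 M + 1
    with s different from 1 involve smaller arguments, and the coefficient 4 M
    - 4 of the term s = 1 vanishes only for M = 1, where both sides are 1. *)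
Lemma jacobi_four_odd_squares M : 0 < M -> Z.odd M -> size (reps4 (4 * M)) = sigma M.
Proof.
move=> M0; have {M0} : 0 <= M by Lia.lia.
move: M; apply: zdescent => M IH M0 oM.
have [->|M1] : M = 1 \/ M <> 1 by Lia.lia.
  have -> : sigma 1 = 1%N by rewrite /sigma (_ : divpairs 1 = [:: (1, 1)]) ?big_seq1 //; vm_compute.
  by vm_compute.
have n5 : (4 * M + 1) mod 8 = 5.
  move: oM => /Z.odd_spec[m ->]; rewrite (_ : _ + 1 = 5 + m * 8); last by ring.
  by rewrite Z_mod_plus_full.
have := etrans (reps_balance (4 * M + 1)) (esym (sigma_balance n5)).
set n := 4 * M + 1 in n5 *.
have i1 : 1 \in one4s n.
  by rewrite mem_one4s (@one4_is 1 0) // zrange_sq // /n; Lia.lia.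
rewrite !(bigD1_seq (1 : Z)) ?one4s_uniq //.
have -> : n - 1 = 4 * M by rewrite /n; ring.
rewrite (_ : 4 * M / 4 = M); last by apply: (@div_unique_exact _ _ _ 0); Lia.lia.
have -> : (\sum_(t <- one4s n | t != 1) ((n - 5 * (t * t)) * Z.of_nat (size (reps4 (n - t * t))))%ZZ =
  \sum_(t <- one4s n | t != 1) ((n - 5 * (t * t)) * Z.of_nat (sigma ((n - t * t) / 4)))%ZZ)%R.
  rewrite big_seq_cond [RHS]big_seq_cond; apply: eq_bigr => t; rewrite mem_one4s.
  move=> /andP[/andP[ot _] /eqP t1]; congr (_ * Z.of_nat _).
  have [q [h -> oq]] := quarter n5 (one4_odd ot); rewrite h.
  have qM : q < M.
    have [j ej] := one4E ot; have j0 : j <> 0 by move=> j0; apply: t1; rewrite ej j0.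
    by move: h; rewrite /n ej; clear -j0; Lia.nia.
  have [q0|q0] : q <= 0 \/ 0 <= q by Lia.lia.
    by rewrite /sigma divpairs_le0 ?reps4_le0 ?big_nil //; Lia.lia.
  by apply: IH.
move=> /addIr; change ((n - 5 * (1 * 1)) * Z.of_nat (size (reps4 (4 * M))) =
  (n - 5 * (1 * 1)) * Z.of_nat (sigma M) -> size (reps4 (4 * M)) = sigma M).
by move=> h; apply: Nat2Z.inj; apply: (Z.mul_reg_l _ _ (n - 5 * (1 * 1))) => //; rewrite /n; Lia.lia.
Qed.

(** * Sums of three odd squares *)

Definition reps3 (n : Z) : seq triple :=
  [seq w <- zbox3 n | one4_triple w && (norm3 w == n)].

Definition same_triple (w : triple) : bool := let: (x, y, z) := w in same x y && same y z.
(** The determinant of the form with Selling parameters x, y, z. *)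
Definition polar (w : triple) : Z := let: (x, y, z) := w in sym2 x y z.

Definition forms3 (n : Z) : seq triple :=
  [seq w <- zbox3 n | [&& one4_triple w, same_triple w & polar w == n]].

Lemma enumerates_reps3 n :
  enumerates (fun w => one4_triple w && (norm3 w == n)) (reps3 n).
Proof.
split; first by rewrite filter_uniq ?zbox3_uniq.
move=> [[x y] z]; rewrite mem_filter mem_zbox3.
case: (boolP (one4_triple _ && _)) => [/andP[_ /Z.eqb_eq nv]|//].
have [|-> -> ->] // := @zrange_norm3 x y z n.
by move: nv; rewrite /norm3; Lia.lia.
Qed.

Lemma mul_gt0_bound x y : 0 < x * y -> Z.abs x <= x * y.
Proof.
move=> h; have [y0|[y0|y0]] := Z.lt_trichotomy 0 y; case: (Z.abs_spec x) => -[? ->]; Lia.nia.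
Qed.

Lemma enumerates_forms3 n :
  enumerates (fun w => [&& one4_triple w, same_triple w & polar w == n]) (forms3 n).
Proof.
split; first by rewrite filter_uniq ?zbox3_uniq.
move=> [[x y] z]; rewrite mem_filter mem_zbox3.
case: (boolP [&& one4_triple _, same_triple _ & _]) => [/and3P[o s /Z.eqb_eq nv]|//].
have [xy yz zx] : [/\ 0 < x * y, 0 < y * z & 0 < z * x] by apply: (@same3_mul_gt0 1).
have := mul_gt0_bound xy; have := mul_gt0_bound yz; have := mul_gt0_bound zx.
rewrite !mem_zrange; move: nv; rewrite /polar /sym2 => nv ? ? ?.
by rewrite andTb; apply/and3P; split; apply/andP; split; apply/Z.leb_spec0; Lia.lia.
Qed.

Lemma reps3_le0 n : n <= 0 -> reps3 n = [::].
Proof.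
move=> n0; have [_ m] := enumerates_reps3 n; case e: (reps3 n) => [//|[[x y] z] l].
have := m (x, y, z); rewrite e mem_head => /esym /andP[/and3P[/one4_neq0 x0 _ _] /Z.eqb_eq].
rewrite /norm3; have := Z.square_nonneg y.
by have := Z.square_nonneg z; Lia.nia.
Qed.

Lemma forms3_le0 n : n <= 0 -> forms3 n = [::].
Proof.
move=> n0; have [_ m] := enumerates_forms3 n; case e: (forms3 n) => [//|[[x y] z] l].
have := m (x, y, z); rewrite e mem_head => /esym /and3P[o s /Z.eqb_eq].
have [xy yz zx] : [/\ 0 < x * y, 0 < y * z & 0 < z * x] by apply: (@same3_mul_gt0 1).
by rewrite /polar /sym2; Lia.lia.
Qed.

Lemma reps4_fibers M :
  size (reps4 M) = (\sum_(s <- one4s M) size (reps3 (M - (s * s)%ZZ)%ZZ))%N.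
Proof.
apply: (size_enumerates_fibers (enumerates_reps4 M) (one4s_uniq M)).
  move=> s [[x y] z] /andP[/and4P[os _ _ _] /Z.eqb_eq nv].
  rewrite mem_one4s os zrange_sq //; move: nv; rewrite /norm4 /norm3.
  by have := Z.square_nonneg x; have := Z.square_nonneg y; have := Z.square_nonneg z; Lia.lia.
move=> s; rewrite mem_one4s => /andP[os _].
have [u m] := enumerates_reps3 (M - s * s); split=> // -[[x y] z]; rewrite m /one4_quad os /one4_triple andTb.
by congr andb; rewrite /norm4; apply/idP/idP => /Z.eqb_eq h; apply/Z.eqb_spec; Lia.lia.
Qed.

Lemma sinksB_fibers M : 0 < M -> Z.odd M ->
  sigma M = (\sum_(s <- one4s (4 * M)) size (forms3 (4 * M - (s * s)%ZZ)%ZZ))%N.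
Proof.
move=> M0 oM; pose P v := [&& one4_quad v, same3 v & disc v == 4 * M].
have h1 s w : P (s, w) -> s \in one4s (4 * M).
  move: w => [[x y] z] /and3P[o s3 /Z.eqb_eq nv]; have /and4P[os _ _ _] := o.
  have [xy yz zx] := same3_mul_gt0 o s3.
  by rewrite mem_one4s os zrange_sq //; move: nv; rewrite /disc /sym2; Lia.lia.
have h2 s : s \in one4s (4 * M) -> enumerates (fun w => P (s, w)) (forms3 (4 * M - s * s)).
  rewrite mem_one4s => /andP[os _].
  have [u m] := enumerates_forms3 (4 * M - s * s); split=> // -[[x y] z]; rewrite m /P /one4_quad os /one4_triple andTb.
  congr [&& _, _ & _]; rewrite /disc /polar; apply/idP/idP => /Z.eqb_eq h; apply/Z.eqb_spec; Lia.lia.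
have eP := enumerates_fibers (P := P) (one4s_uniq _) h1 h2.
rewrite -(size_sinksB M0 oM eP).
exact: (size_enumerates_fibers eP (one4s_uniq _) h1 h2).
Qed.

(** Both sides, evaluated at 4 M - s^2 and summed over s = 1 modulo 4, equal
    sigma M, and all terms but s = 1 are known by induction. *)
Lemma size_reps3_forms3 M : 0 <= M -> Z.odd M ->
  size (reps3 (4 * M - 1)) = size (forms3 (4 * M - 1)).
Proof.
move: M; apply: zdescent => M IH M0 oM.
have {}M0 : 0 < M by case: (Z.eq_dec M 0) => [e|]; [rewrite e in oM | Lia.lia].
have := etrans (esym (reps4_fibers (4 * M))) (etrans (jacobi_four_odd_squares M0 oM) (sinksB_fibers M0 oM)).
have i1 : 1 \in one4s (4 * M).
  by rewrite mem_one4s (@one4_is 1 0) // zrange_sq //; Lia.lia.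
rewrite !(bigD1_seq (1 : Z)) ?one4s_uniq //.
have -> : (\sum_(s <- one4s (4 * M) | s != 1%ZZ) size (reps3 (4 * M - (s * s)%ZZ)%ZZ) =
  \sum_(s <- one4s (4 * M) | s != 1%ZZ) size (forms3 (4 * M - (s * s)%ZZ)%ZZ))%N.
  rewrite big_seq_cond [RHS]big_seq_cond; apply: eq_bigr => s; rewrite mem_one4s.
  move=> /andP[/andP[os _] /eqP s1].
  have [k ek] := odd_sq_mod8 (one4_odd os).
  have -> : 4 * M - s * s = 4 * (M - 2 * k) - 1 by Lia.lia.
  have [q0|q0] : M - 2 * k <= 0 \/ 0 <= M - 2 * k by Lia.lia.
    by rewrite reps3_le0 ?forms3_le0 //; Lia.lia.
  apply: IH.
    have [j ej] := one4E os; have j0 : j <> 0 by move=> j0; apply: s1; rewrite ej j0.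
    by move: ek; rewrite ej; clear -j0 q0; Lia.nia.
  by rewrite Z.odd_sub Z.odd_mul /= oM.
by move=> /addIn.
Qed.

(** The form with Selling parameters (1, 1, 2 M - 1) is reduced of determinant
    4 M - 1, so the equinumerous set of representations is not empty. *)
Lemma three_odd_squares M : 0 < M -> Z.odd M ->
  exists x y z : Z, 4 * M - 1 = x * x + y * y + z * z.
Proof.
move=> M0 oM; have h := @size_reps3_forms3 M (Z.lt_le_incl _ _ M0) oM.
have : (1, 1, 2 * M - 1) \in forms3 (4 * M - 1).
  have [_ ->] := enumerates_forms3 (4 * M - 1).
  move: oM M0 => /Z.odd_spec[m ->] M0; apply/and3P; split.
  - apply/and3P; split; rewrite ?(@one4_is 1 0) //.
    by apply: (@one4_is _ m); Lia.lia.
  - by rewrite /same_triple; split_signs.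
  by apply/Z.eqb_spec; rewrite /polar /sym2; ring.
case: (forms3 _) h => // w l; have [_ m] := enumerates_reps3 (4 * M - 1).
case: (reps3 _) m => // -[[x y] z] l' /(_ (x, y, z)); rewrite mem_head => /esym /andP[_ /Z.eqb_eq e] _ _.
by exists x, y, z; rewrite -e.
Qed.

(** * The forest of ideal quadrilaterals *)

(** A quadruple stands for the matrix with rows (a, b + s) and (b - s, c).
    These congruences are preserved by the four reflections, and they ensure
    that every edge is chosen by exactly one of its ends. *)
Definition admissible (v : quad) : Prop :=
  let: (s, (a, b, c)) := v in
  exists i j k, [/\ a = 2 * i + 1, s = b + 2 * j & c = 2 * i + 1 - 2 * b - 4 * k].

(** Left multiplication of the matrix by the reflections in the sides of the
    ideal quadrilateral with vertices -1, 0, 1 and infinity. They generate a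
    free product of four groups of order 2. *)
Definition flipA (i : nat) (v : quad) : quad :=
  let: (s, (a, b, c)) := v in
  match i with
  | 0%N => (b - a, (a, s + a, 2 * s + 2 * b - c))
  | 1%N => (b + a, (a, s - a, - 2 * s - 2 * b - c))
  | 2%N => (b - c, (a + 2 * s - 2 * b, s - c, - c))
  | _ => (b + c, (a - 2 * s + 2 * b, s + c, - c))
  end.

(** The side through which the reduction leaves when a is positive, and None
    in the fundamental domain |b| <= a, |b| <= c, of whose boundary a part
    depending on s is kept. On the boundary, and for indefinite forms, s
    decides, so that crossing a side reverses the choice. *)
Definition ruleA_pos (v : quad) : option nat :=
  let: (s, (a, b, c)) := v in
  let P3 := (b <? c) || ((b =? c) && (0 <? 2 * (s - b) + a)) in
  let P4 := (0 <? c + b) || ((c + b =? 0) && (0 <? 2 * (s - b) - a)) in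
  if 0 <? c then
    if (0 <? a + b) && P4 then
      if (b <=? a) && P3 then None
      else if 0 <? s then Some (if P3 && (0 <? a + c - 2 * b) then 0%N else 2%N)
      else Some (if (b <=? a) && (0 <? a + c - 2 * b) then 2%N else 0%N)
    else if 0 <? s then Some (if (0 <? a + b) && (0 <? a + c + 2 * b) then 3%N else 1%N)
    else Some (if P4 && (0 <? a + c + 2 * b) then 1%N else 3%N)
  else if 0 <? s then Some (if 0 <? a + c + 2 * b then 3%N else 1%N)
  else Some (if 0 <? a + c - 2 * b then 2%N else 0%N).

Definition negA (v : quad) : quad := let: (s, (a, b, c)) := v in (- s, (- a, - b, - c)).

Definition ruleA (v : quad) : option nat :=
  let: (s, (a, b, c)) := v in if 0 <? a then ruleA_pos v else ruleA_pos (negA v).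

(** Case analysis on all comparisons of a goal, pruned by linear arithmetic at
    every split. *)
Ltac split_cmp :=
  repeat (match goal with
  | |- context [Z.ltb 0 ?t] => case: (Z.ltb_spec 0 t) => ?; cbn -[Z.add Z.mul Z.opp Z.sub]; try (exfalso; Lia.lia)
  | |- context [Z.ltb ?a ?t] => case: (Z.ltb_spec a t) => ?; cbn -[Z.add Z.mul Z.opp Z.sub]; try (exfalso; Lia.lia)
  | |- context [Z.leb ?a ?t] => case: (Z.leb_spec a t) => ?; cbn -[Z.add Z.mul Z.opp Z.sub]; try (exfalso; Lia.lia)
  | |- context [Z.eqb ?a ?t] => case: (Z.eqb_spec a t) => ?; cbn -[Z.add Z.mul Z.opp Z.sub]; try (exfalso; Lia.lia)
  end).

(** Each edge is chosen by exactly one of its ends; the same holds for the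
    three other sides below. *)
Lemma ruleA_flip0 v : admissible v ->
  (ruleA (flipA 0 v) == Some 0%N) = (ruleA v != Some 0%N).
Proof.
move: v => [s [[a b] c]] [i [j [k [-> -> ->]]]].
rewrite /ruleA /negA /ruleA_pos /flipA.
by split_cmp.
Qed.

Lemma ruleA_flip1 v : admissible v ->
  (ruleA (flipA 1 v) == Some 1%N) = (ruleA v != Some 1%N).
Proof.
move: v => [s [[a b] c]] [i [j [k [-> -> ->]]]].
rewrite /ruleA /negA /ruleA_pos /flipA.
by split_cmp.
Qed.

Lemma ruleA_flip2 v : admissible v ->
  (ruleA (flipA 2 v) == Some 2%N) = (ruleA v != Some 2%N).
Proof.
move: v => [s [[a b] c]] [i [j [k [-> -> ->]]]].
rewrite /ruleA /negA /ruleA_pos /flipA.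
by split_cmp.
Qed.

Lemma ruleA_flip3 v : admissible v ->
  (ruleA (flipA 3 v) == Some 3%N) = (ruleA v != Some 3%N).
Proof.
move: v => [s [[a b] c]] [i [j [k [-> -> ->]]]].
rewrite /ruleA /negA /ruleA_pos /flipA.
by split_cmp.
Qed.

(** The action of the reflections on a column of the matrix, its second entry
    being taken with the opposite sign. *)
Definition flip_column (i : nat) (p : Z * Z) : Z * Z :=
  match i with
  | 0%N => (p.1, - p.2 - 2 * p.1)
  | 1%N => (p.1, - p.2 + 2 * p.1)
  | 2%N => (p.1 + 2 * p.2, - p.2)
  | _ => (p.1 - 2 * p.2, - p.2)
  end.

Definition l1 (p : Z * Z) : Z := Z.abs p.1 + Z.abs p.2.

Definition opposite (x y : Z) : bool := (0 <? x) && (0 <? - y) || (0 <? - x) && (0 <? y).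

Definition shrinks (i : nat) (p : Z * Z) : bool :=
  match i with
  | 0%N => opposite p.1 (p.1 + p.2)
  | 1%N => opposite p.1 (p.1 - p.2)
  | 2%N => opposite p.2 (p.2 + p.1)
  | _ => opposite p.2 (p.2 - p.1)
  end.

(** A reflection replaces, up to sign, one entry by its mirror image in plus
    or minus the other; the image is nearer to 0 exactly when the entry lies
    beyond the mirror point. *)
Lemma l1_flip_column i p : (l1 (flip_column i p) <? l1 p) = shrinks i p.
Proof.
case: p => x y; rewrite /shrinks /l1 /flip_column /opposite.
case: i => [|[|[|i]]]; cbn [fst snd]; case: Z.ltb_spec => ?.
all: by split_cmp.
Qed.

(** Along a path without backtracking the norm of a column is convex: after it
    has stopped decreasing it never decreases again. *)
Lemma l1_convex i j p : i != j -> (i < 4)%N -> (j < 4)%N ->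
  (l1 p <=? l1 (flip_column i p)) ==> (l1 (flip_column i p) <=? l1 (flip_column j (flip_column i p))).
Proof.
case: p => x y ij i4 j4; apply/implyP => /Z.leb_spec0 h; apply/Z.leb_spec0; move: ij i4 j4 h.
rewrite /l1 /flip_column.
by case: i => [|[|[|[|i]]]] //; case: j => [|[|[|[|j]]]] //; cbn [fst snd] => *; Lia.lia.
Qed.

(** The two columns, their sum and their difference, with the sign of the
    second entry reversed. The norm of a single column need not decrease along
    a chosen edge. *)
Definition column_vectors : seq (quad -> Z * Z) :=
  [:: (fun v => let: (s, (a, b, c)) := v in (a, s - b));
      (fun v => let: (s, (a, b, c)) := v in (- (s + b), c));
      (fun v => let: (s, (a, b, c)) := v in (a + s + b, s - b - c));
      (fun v => let: (s, (a, b, c)) := v in (a - s - b, s - b + c))].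

Lemma column_vectors_flipA i v : (i < 4)%N ->
  all (fun f => f (flipA i v) == flip_column i (f v)) column_vectors.
Proof.
move: v => [s [[a b] c]] i4; rewrite /column_vectors /flip_column /flipA.
rewrite /all andbT.
by case: i i4 => [|[|[|[|i]]]] // _; apply/and4P; split; apply/eqP; congr (_, _); cbn [fst snd]; Lia.lia.
Qed.

Lemma opposite_true x y : 0 < x /\ 0 < - y \/ 0 < - x /\ 0 < y -> opposite x y.
Proof. by case=> -[/Z.ltb_spec0 h1 /Z.ltb_spec0 h2]; rewrite /opposite h1 h2 ?orbT. Qed.

(** The two quantities whose opposite signs mean that the norm decreases. *)
Definition sides (i : nat) (x y : Z) : Z * Z :=
  match i with
  | 0%N => (x, x + y)
  | 1%N => (x, x - y)
  | 2%N => (y, y + x)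
  | _ => (y, y - x)
  end.

Lemma shrinksE i p : shrinks i p = opposite (sides i p.1 p.2).1 (sides i p.1 p.2).2.
Proof. by case: i => [|[|[|i]]]. Qed.

(** At least one of the four norms decreases along every chosen edge. *)
Lemma ruleA_decreases v : admissible v ->
  if ruleA v is Some i then has (fun f => shrinks i (f v)) column_vectors else true.
Proof.
move: v => [s [[a b] c]] [i [j [k [-> -> ->]]]].
set s' := b + 2 * j; set a' := 2 * i + 1; set c' := a' - 2 * b - 4 * k.
pose op n x y := let: (x, y) := sides n x y in 0 < x /\ 0 < - y \/ 0 < - x /\ 0 < y.
have GP n : op n a' (s' - b) \/ op n (- (s' + b)) c' \/ op n (a' + s' + b) (s' - b - c') \/
     op n (a' - s' - b) (s' - b + c') ->
   has (fun f => shrinks n (f (s', (a', b, c')))) column_vectors.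
  rewrite /column_vectors /has orbF !shrinksE; cbn [fst snd] => h; apply/or4P; move: h; rewrite /op.
  by case=> [h|[h|[h|h]]]; [apply: Or41|apply: Or42|apply: Or43|apply: Or44]; apply: opposite_true; move: h; case: (sides _ _ _).
set R := ruleA _; pose G n := has (fun f => shrinks n (f (s', (a', b, c')))) column_vectors.
rewrite -[is_true _]/(is_true (if R is Some n then G n else true)).
have {}GP n := GP n : _ -> G n; clearbody G; move: GP; rewrite /op /s' /a' /c' => GP; rewrite /R /s' /a' /c' {R}.
rewrite /ruleA /negA /ruleA_pos.
split_cmp; try done; apply: GP; rewrite /sides.
all: Lia.lia.
Qed.

(** The determinant of the matrix. *)
Definition discA (v : quad) : Z := let: (s, (a, b, c)) := v in s * s + a * c - b * b.

Definition onA (M : Z) (v : quad) : bool :=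
  let: (s, (a, b, c)) := v in
  [&& Z.odd a, Z.even (s - b), (a - 2 * b - c) mod 4 =? 0 & Z.abs (discA v) =? M].

Lemma admissibleI s a b c : a mod 2 = 1 -> (s - b) mod 2 = 0 -> (a - 2 * b - c) mod 4 = 0 ->
  admissible (s, (a, b, c)).
Proof.
move=> h1 h2 h3; exists (a / 2), ((s - b) / 2), ((a - 2 * b - c) / 4).
have := Z.div_mod a 2; have := Z.div_mod (s - b) 2; have := Z.div_mod (a - 2 * b - c) 4.
by rewrite h1 h2 h3; split; Lia.lia.
Qed.

Lemma onA_admissible M v : onA M v -> admissible v.
Proof.
move: v => [s [[a b] c]] /and4P[/Z.odd_spec[i hi] /Z.even_spec[j hj] /Z.eqb_spec h _].
apply: admissibleI => //.
  by rewrite hi Z.add_comm Z.mul_comm Z.mod_add.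
by rewrite hj Z.mul_comm Z.mod_mul.
Qed.

Lemma admissible_onA M v : admissible v -> Z.abs (discA v) = M -> onA M v.
Proof.
move: v => [s [[a b] c]] [i [j [k [-> -> ->]]]] /Z.eqb_spec h; rewrite /onA h andbT.
apply/and3P; split; [by apply/Z.odd_spec; exists i| |apply/Z.eqb_spec].
  by apply/Z.even_spec; exists j; ring.
rewrite (_ : _ - _ = k * 4); last by ring.
by rewrite Z.mod_mul.
Qed.

Lemma onA_disc M v : onA M v -> Z.abs (discA v) = M.
Proof. by move: v => [s [[a b] c]] /and4P[_ _ _ /Z.eqb_spec]. Qed.

Lemma flipA_admissible i v : admissible v -> admissible (flipA i v).
Proof.
move: v => [s [[a b] c]] [x [y [z [-> -> ->]]]].
rewrite /flipA; case: i => [|[|[|i]]].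
- by exists x, (- y - 2 * x - 1), (- 2 * b - 2 * y - z); split; ring.
- by exists x, (2 * x + 1 - y), (2 * x + 1 - z); split; ring.
- by exists (x + 2 * y), (- y), (2 * x + 1 - 2 * b - 3 * z); split; ring.
by exists (x - 2 * y), (- y), (z - 2 * y); split; ring.
Qed.

Lemma flipA_disc i v : discA (flipA i v) = - discA v.
Proof. by move: v => [s [[a b] c]]; rewrite /flipA; case: i => [|[|[|i]]]; rewrite /discA; ring. Qed.

Lemma flipAK i v : flipA i (flipA i v) = v.
Proof.
move: v => [s [[a b] c]]; rewrite /flipA.
by case: i => [|[|[|i]]]; congr (_, (_, _, _)); ring.
Qed.

(** Stretching the second column of the matrix by 4 k + 1. A factor congruent
    to 1 modulo 4 respects the congruences. *)
Definition scaleA (k : Z) (v : quad) : quad :=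
  let: (s, (a, b, c)) := v in
  (s + 2 * k * (s + b), (a, b + 2 * k * (s + b), c + 4 * k * c)).

Lemma scaleA_admissible k v : admissible v -> admissible (scaleA k v).
Proof.
move: v => [s [[a b] c]] [x [y [z [-> -> ->]]]].
exists x, y, (z - k * (b + 2 * y + b) - k * (2 * x + 1 - 2 * b - 4 * z)).
by split; ring.
Qed.

Lemma scaleA_flip k i v : scaleA k (flipA i v) = flipA i (scaleA k v).
Proof.
move: v => [s [[a b] c]]; rewrite /flipA /scaleA.
by case: i => [|[|[|i]]]; congr (_, (_, _, _)); ring.
Qed.

Lemma ruleA_lt4 v i : ruleA v = Some i -> (i < 4)%N.
Proof.
suff pos w : ruleA_pos w = Some i -> (i < 4)%N.
  by move: v => [s [[a b] c]]; rewrite /ruleA; case: ifP => _; apply: pos.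
move: w => [s [[a b] c]]; rewrite /ruleA_pos.
by repeat case: ifP => _ //; case=> <-.
Qed.

Lemma ruleA_flip i v : (i < 4)%N -> admissible v ->
  (ruleA (flipA i v) == Some i) = (ruleA v != Some i).
Proof.
case: i => [|[|[|[|//]]]] _.
- exact: ruleA_flip0.
- exact: ruleA_flip1.
- exact: ruleA_flip2.
exact: ruleA_flip3.
Qed.

Definition nextA (k : Z) (v : quad) : option quad :=
  omap (fun i => flipA i v) (ruleA (scaleA k v)).

Definition adjA (v w : quad) : Prop := exists2 i, (i < 4)%N & w = flipA i v.

Lemma adjA_onA M v w : onA M v -> adjA v w -> onA M w.
Proof.
move=> Vv [i _ ->]; apply: admissible_onA; first exact: flipA_admissible (onA_admissible Vv).
by rewrite flipA_disc Z.abs_opp (onA_disc Vv).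
Qed.

Lemma to_nat_leq x y : 0 <= x -> 0 <= y -> (Z.to_nat x <= Z.to_nat y)%N = (x <=? y).
Proof.
by move=> hx hy; apply/idP/idP => [/ssrnat.leP h|/Z.leb_spec0 h]; [apply/Z.leb_spec0|apply/ssrnat.leP]; Lia.lia.
Qed.

Lemma l1_ge0 p : 0 <= l1 p.
Proof. by rewrite /l1; Lia.lia. Qed.

(** The stretching commutes with the reflections, so every k orients one and
    the same forest. *)
Lemma orientedA k M : oriented_by (onA M) adjA (nextA k).
Proof.
have step v w : nextA k v = Some w -> exists i, [/\ (i < 4)%N, ruleA (scaleA k v) = Some i & w = flipA i v].
  rewrite /nextA; case e: (ruleA _) => [i|] // [<-]; exists i; split=> //.
  exact: ruleA_lt4 e.
split.
- by move=> v w _ /step[i [i4 _ ->]]; exists i.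
- move=> v w Vv [i i4 ->]; have ok := scaleA_admissible k (onA_admissible Vv).
  have := ruleA_flip i4 ok; case: eqP => [e _|_ /esym /eqP e]; last first.
    by left; rewrite /nextA e.
  by right; rewrite /nextA scaleA_flip e /= flipAK.
apply: (drains_exists (ms := [seq (fun v => Z.to_nat (l1 (f (scaleA k v)))) | f <- column_vectors])).
- by move=> v w Vv /step[i [i4 _ ->]]; apply: adjA_onA Vv _; exists i.
- move=> v w Vv /step[i [i4 e ->]]; have := ruleA_decreases (scaleA_admissible k (onA_admissible Vv)).
  rewrite e has_map => h.
  have := column_vectors_flipA (scaleA k v) i4; rewrite -scaleA_flip.
  elim: column_vectors h => //= f s IH /orP[d|/IH{}IH] /andP[/eqP e1 /IH{}IH']; last by rewrite IH' orbT.
  apply/orP; left; rewrite e1; move: d; rewrite -l1_flip_column => /Z.ltb_spec0.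
  by move=> h; apply/ssrnat.ltP; have := @l1_ge0 (flip_column i (f (scaleA k v))); Lia.lia.
move=> v w z Vv /step[i [i4 e ->]] /step[j [j4 e' ->]].
have ij : i != j.
  apply/eqP => ij; have := ruleA_flip i4 (scaleA_admissible k (onA_admissible Vv)).
  by rewrite -scaleA_flip e' ij e -ij !eqxx.
have := column_vectors_flipA (scaleA k v) i4.
have := column_vectors_flipA (scaleA k (flipA i v)) j4; rewrite -!scaleA_flip all_map.
elim: column_vectors => //= f s IH /andP[/eqP e2 h2] /andP[/eqP e1 h1]; apply/andP; split; last exact: IH.
by rewrite e2 e1 !(to_nat_leq (@l1_ge0 _) (@l1_ge0 _)); apply: l1_convex.
Qed.

(** * Sinks after stretching *)

(** Matrices whose upper right entry b + s is zero, with positive diagonal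
    entries a and c, and with b reduced modulo 2 a. *)
Definition rootA (M : Z) (v : quad) : bool :=
  let: (s, (a, b, c)) := v in
  [&& s == - b, 0 <? a, 0 <? c, a * c == M, (a - 2 * b - c) mod 4 =? 0, - a <? b & b <=? a].

(** The congruence fixes the parity of b, which leaves exactly a values of b
    between - a and a; the last summand adjusts the parity. *)
Definition rootA_of (t : Z * Z * Z) : quad :=
  let: (a, c, j) := t in
  let b := 2 * j - a + 1 + ((a - c) / 2) mod 2 in (- b, (a, b, c)).

Definition of_rootA (v : quad) : Z * Z * Z :=
  let: (s, (a, b, c)) := v in (a, c, (b + a - 1) / 2).

Lemma rootA_ofP M t : Z.odd M -> sigma_triple M t ->
  rootA M (rootA_of t) /\ of_rootA (rootA_of t) = t.
Proof.
move: t => [[a c] j] oM /and5P[/Z.ltb_spec0 a0 /Z.ltb_spec0 c0 /eqP ac /Z.leb_spec0 j0 /Z.ltb_spec0 ja].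
have /andP[/Z.odd_spec[x ex] /Z.odd_spec[y ey]] := odd_factors ac oM.
rewrite /rootA_of; have -> : (a - c) / 2 = x - y by apply: (@div_unique_exact _ _ _ 0); Lia.lia.
have := Z.div_mod (x - y) 2; have := Z.mod_pos_bound (x - y) 2.
set e := _ mod 2; set q := _ / 2 => he hq; split.
  apply/and5P; split; rewrite ?eqxx //; [exact/Z.ltb_spec0|exact/Z.ltb_spec0|exact/eqP|].
  apply/and3P; split; last 2 first; [apply/Z.ltb_spec0; Lia.lia|apply/Z.leb_spec0; Lia.lia|].
  apply/Z.eqb_spec; rewrite (_ : a - _ - c = (q - j + x) * 4) ?Z.mod_mul //. Lia.lia.
rewrite /of_rootA; congr (_, _).
by apply: (@div_unique_exact _ _ _ e); Lia.lia.
Qed.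

Lemma of_rootAP M v : Z.odd M -> rootA M v ->
  sigma_triple M (of_rootA v) /\ rootA_of (of_rootA v) = v.
Proof.
move: v => [s [[a b] c]] oM /and5P[/eqP -> /Z.ltb_spec0 a0 /Z.ltb_spec0 c0 /eqP ac].
move=> /and3P[/Z.eqb_spec h /Z.ltb_spec0 b1 /Z.leb_spec0 b2].
have /andP[/Z.odd_spec[x ex] /Z.odd_spec[y ey]] := odd_factors ac oM.
rewrite /of_rootA /rootA_of; have -> : (a - c) / 2 = x - y by apply: (@div_unique_exact _ _ _ 0); Lia.lia.
have := Z.div_mod (x - y) 2; have := Z.mod_pos_bound (x - y) 2.
have := Z.div_mod (a - 2 * b - c) 4; rewrite h.
set e := _ mod 2; set q := _ / 2; set r := _ / 4 => hr he hq.
have [e0|e1] : e = 0 \/ e = 1 by Lia.lia.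
  have -> : (b + a - 1) / 2 = q - r + x by apply: (@div_unique_exact _ _ _ 0); Lia.lia.
  split; last by rewrite e0; congr (_, (_, _, _)); Lia.lia.
  by apply/and5P; split; rewrite ?(introT eqP ac) //; [exact/Z.ltb_spec0|exact/Z.ltb_spec0|apply/Z.leb_spec0; Lia.lia|apply/Z.ltb_spec0; Lia.lia].
have -> : (b + a - 1) / 2 = q - r + x by apply: (@div_unique_exact _ _ _ 1); Lia.lia.
split; last by rewrite e1; congr (_, (_, _, _)); Lia.lia.
by apply/and5P; split; rewrite ?(introT eqP ac) //; [exact/Z.ltb_spec0|exact/Z.ltb_spec0|apply/Z.leb_spec0; Lia.lia|apply/Z.ltb_spec0; Lia.lia].
Qed.

(** The fundamental domain |b| <= a, |b| <= c for positive a. Of its sides b =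
    - a is excluded, while on b = c and b = - c membership depends on s. *)
Definition sinkA_pos (v : quad) : bool :=
  let: (s, (a, b, c)) := v in
  [&& 0 <? a, 0 <? c, - a <? b, b <=? a,
      (b <? c) || (b =? c) && (0 <? 2 * (s - b) + a)
    & (- c <? b) || (b =? - c) && (0 <? 2 * (s - b) - a)].

Lemma ruleA_pos_sink s a b c : 0 < a ->
  (ruleA_pos (s, (a, b, c)) == None) = sinkA_pos (s, (a, b, c)).
Proof.
move=> /Z.ltb_spec0 a0; rewrite /ruleA_pos /sinkA_pos a0.
have -> : (0 <? a + b) = (- a <? b) by apply/idP/idP => /Z.ltb_spec0 ?; apply/Z.ltb_spec0; Lia.lia.
have -> : (0 <? c + b) = (- c <? b) by apply/idP/idP => /Z.ltb_spec0 ?; apply/Z.ltb_spec0; Lia.lia.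
have -> : (c + b =? 0) = (b =? - c) by apply/idP/idP => /Z.eqb_spec ?; apply/Z.eqb_spec; Lia.lia.
set P3 := (b <? c) || _; set P4 := (- c <? b) || _.
case: (0 <? c); last by case: ifP; case: ifP.
by case: (- a <? b); case: P4; case: (b <=? a); case: P3; repeat (reflexivity || case: ifP => _).
Qed.

Lemma negAK v : negA (negA v) = v.
Proof. by move: v => [s [[a b] c]]; rewrite /negA !Z.opp_involutive. Qed.

Lemma ruleA_sink M v : onA M v -> (ruleA v == None) = sinkA_pos v || sinkA_pos (negA v).
Proof.
move: v => [s [[a b] c]] /and4P[/Z.odd_spec[x ex] _ _ _]; rewrite /ruleA.
case: Z.ltb_spec => a0.
  rewrite ruleA_pos_sink //; have -> : sinkA_pos (negA (s, (a, b, c))) = false; last by rewrite orbF.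
  by rewrite /sinkA_pos /negA; case: Z.ltb_spec => //= ?; Lia.lia.
rewrite /negA ruleA_pos_sink; last Lia.lia.
have -> : sinkA_pos (s, (a, b, c)) = false by rewrite /sinkA_pos; case: Z.ltb_spec => //= ?; Lia.lia.
by [].
Qed.

Lemma sinkA_pos_ge s a b c : sinkA_pos (s, (a, b, c)) ->
  [/\ 0 < a, 0 < c, - a < b <= a & - c <= b <= c].
Proof.
move=> /and5P[/Z.ltb_spec0 ? /Z.ltb_spec0 ? /Z.ltb_spec0 ? /Z.leb_spec0 ? /andP[/orP h1 /orP h2]].
split=> //; split.
  by case: h2 => [/Z.ltb_spec0 ?|/andP[/Z.eqb_spec ? _]]; Lia.lia.
by case: h1 => [/Z.ltb_spec0 ?|/andP[/Z.eqb_spec ? _]]; Lia.lia.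
Qed.

(** After stretching by K = 4 M + 1 the square of s is at most K M, hence
    small, so if the upper right entry v = s + b were nonzero, the stretched b
    would be near the multiple K v of K. As c is odd and v even, the
    determinant of the stretched form would then exceed K M. *)
Lemma scaled_sinkA_root M v : 0 < M -> onA M v -> sinkA_pos (scaleA M v) -> rootA M v.
Proof.
move: v => [s [[a b] c]] M0 ov sv; have /and4P[oa _ m4 /Z.eqb_spec dv] := ov.
have [i [j [k [ea es ec]]]] := onA_admissible ov.
move: sv; rewrite /scaleA => /sinkA_pos_ge[a0 c0 ba bc].
have c1 : 0 < c by clear -c0 M0; Lia.nia.
pose b' := b + 2 * M * (s + b); pose s' := s + 2 * M * (s + b).
(* In the stretched matrix the determinant is a square plus the determinant of
   a semidefinite form, so it is positive and both are at most K M. *)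
have id1 : s' * s' + a * (c + 4 * M * c) - b' * b' = (4 * M + 1) * discA (s, (a, b, c)).
  by rewrite /s' /b' /discA; ring.
have id2 : s' + b' = (4 * M + 1) * (s + b) by rewrite /s' /b'; ring.
rewrite -/b' in ba bc; set c' := c + 4 * M * c in id1 bc c0.
have bb : b' * b' = Z.abs b' * Z.abs b' by rewrite Z.abs_square.
have h1 : Z.abs b' <= a by Lia.lia.
have h2 : Z.abs b' <= c' by Lia.lia.
have h3 : Z.abs b' * Z.abs b' <= a * c' by clear -h1 h2; Lia.nia.
have dM : discA (s, (a, b, c)) = M.
  have : 0 <= s' * s' by exact: Z.square_nonneg.
  have : 0 < M * (4 * M + 1) by clear -M0; Lia.nia.
  case: (Z.abs_eq_or_opp (discA (s, (a, b, c)))) => h; first by Lia.lia.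
  have -> : discA (s, (a, b, c)) = - M by Lia.lia.
  by Lia.lia.
have ss : Z.abs s' <= 2 * M.
  have := Z.abs_square s'; have : s' * s' <= (4 * M + 1) * M by Lia.lia.
  by have := Z.abs_nonneg s'; clear -M0; move=> ? ? ?; Lia.nia.
have v0 : s + b = 0.
  have [//|vn] := Z.eq_dec (s + b) 0; exfalso.
  have v2 : 2 <= Z.abs (s + b) by Lia.lia.
  have id3 : (4 * M + 1) * Z.abs (s + b) <= Z.abs b' + 2 * M.
    by rewrite -{1}(Z.abs_eq (4 * M + 1)) -?Z.abs_mul; Lia.lia.
  have ck : (4 * M + 1) * Z.abs (s + b) <= (4 * M + 1) * c + 2 * M by Lia.lia.
  have cv : Z.abs (s + b) <= c by clear -ck M0; Lia.nia.
  (* c is odd while s + b is even. *)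
  have {}cv : Z.abs (s + b) + 1 <= c by Lia.lia.
  have h4 : (4 * M + 1) * (Z.abs (s + b) + 1) <= c' by rewrite /c'; clear -cv M0; Lia.nia.
  have h5 : 6 * M + 2 <= Z.abs b' by clear -id3 v2 M0; Lia.nia.
  have h6 : Z.abs b' + (2 * M + 1) <= c' by Lia.lia.
  have h7 : Z.abs b' * (2 * M + 1) <= a * c' - b' * b' by rewrite bb; clear -h1 h5 h6 M0; Lia.nia.
  have h8 : (6 * M + 2) * (2 * M + 1) <= Z.abs b' * (2 * M + 1) by clear -h5 M0; Lia.nia.
  by move: id1 (Z.square_nonneg s'); rewrite dM; clear -h7 h8 M0; Lia.nia.
have sb : s = - b by Lia.lia.
have b0 : b' = b by rewrite /b' v0; ring.
have ac : a * c = M by rewrite -dM /discA sb; ring.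
rewrite b0 in ba; apply/and5P; split; [exact/eqP|exact/Z.ltb_spec0|exact/Z.ltb_spec0|exact/eqP|].
by apply/and3P; split; [|apply/Z.ltb_spec0|apply/Z.leb_spec0]; Lia.lia || done.
Qed.

Lemma root_scaled_sinkA M v : 0 < M -> Z.odd M -> rootA M v -> onA M v /\ sinkA_pos (scaleA M v).
Proof.
move: v => [s [[a b] c]] M0 oM /and5P[/eqP -> /Z.ltb_spec0 a0 /Z.ltb_spec0 c0 /eqP ac].
move=> /and3P[/Z.eqb_spec h /Z.ltb_spec0 b1 /Z.leb_spec0 b2].
have /andP[oa _] := odd_factors ac oM.
have aM : a <= M by clear -ac a0 c0; Lia.nia.
have cK : 4 * M + 1 <= c + 4 * M * c by clear -c0 M0; Lia.nia.
split.
  apply/and4P; split=> //; [by apply/Z.even_spec; exists (- b); ring|exact/Z.eqb_spec|].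
  by apply/Z.eqb_spec; rewrite /discA; Lia.lia.
rewrite /scaleA (_ : - b + b = 0) ?Z.mul_0_r ?Z.add_0_r; last by ring.
apply/and5P; split; [exact/Z.ltb_spec0|apply/Z.ltb_spec0; Lia.lia|exact/Z.ltb_spec0|exact/Z.leb_spec0|].
by apply/andP; split; apply/orP; left; apply/Z.ltb_spec0; Lia.lia.
Qed.

Lemma onA_negA M v : onA M (negA v) = onA M v.
Proof.
move: v => [s [[a b] c]]; rewrite /negA /onA Z.odd_opp.
rewrite (_ : - s - - b = - (s - b)) ?Z.even_opp; last by ring.
rewrite (_ : discA _ = discA (s, (a, b, c))); last by rewrite /discA; ring.
case: (Z.odd a) => //; case: (Z.even _) => //; rewrite !andTb; congr (_ && _).
rewrite (_ : - a - _ - _ = - (a - 2 * b - c)); last by ring.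
apply/idP/idP => /Z.eqb_spec /Z.mod_divide h; apply/Z.eqb_spec/Z.mod_divide => //.
  by apply/Z.divide_opp_r; apply: h.
by apply/Z.divide_opp_r; apply: h.
Qed.

Lemma scaleA_negA k v : scaleA k (negA v) = negA (scaleA k v).
Proof. by move: v => [s [[a b] c]]; rewrite /negA /scaleA; congr (_, (_, _, _)); ring. Qed.

Lemma scaleA0 v : scaleA 0 v = v.
Proof. by move: v => [s [[a b] c]]; rewrite /scaleA; congr (_, (_, _, _)); ring. Qed.

Lemma sinkA_pos_negA v : sinkA_pos v -> ~~ sinkA_pos (negA v).
Proof.
move: v => [s [[a b] c]] /sinkA_pos_ge[a0 _ _ _]; apply/negP => /sinkA_pos_ge[? _ _ _]; Lia.lia.
Qed.

(** Counting the sinks after stretching by 4 M + 1: they come in two opposite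
    families, each parametrized by divisors a of M and a residue modulo a. *)
Lemma size_sinksA M l : 0 < M -> Z.odd M ->
  enumerates (fun v => onA M v && (sinkA_pos v || sinkA_pos (negA v))) l ->
  size l = (2 * sigma M)%N.
Proof.
move=> M0 oM el; have [m [em <-]] := sigma_triples M.
have er : enumerates (rootA M) (map rootA_of m).
  apply: (enumerates_map (g := of_rootA) em) => [t|r]; first exact: rootA_ofP.
  exact: of_rootAP.
have rootP v : rootA M v = onA M v && sinkA_pos (scaleA M v).
  by apply/idP/andP => [/root_scaled_sinkA[]|[]] //; exact: scaled_sinkA_root.
have es : enumerates (fun v => onA M v && (nextA M v == None))
    (map rootA_of m ++ map (negA \o rootA_of) m).
  rewrite map_comp; apply: (enumerates_double negAK _ _ er) => v; rewrite !rootP onA_negA scaleA_negA.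
    by move=> /andP[_ /sinkA_pos_negA/negPf ->]; rewrite andbF.
  rewrite -andb_orr; case: (boolP (onA M v)) => //= ov; rewrite /nextA.
  have := scaleA_admissible M (onA_admissible ov) => /admissible_onA/(_ erefl)/ruleA_sink <-.
  by case: (ruleA _).
rewrite mul2n -addnn -{1}(size_map rootA_of m) -[X in (_ + X)%N](size_map (negA \o rootA_of)) -size_cat.
apply: (size_sinks (V := onA M) (@adjA_onA M) (orientedA 0 M) (orientedA M M)) => //.
case: el => ul ml; split=> // v; rewrite ml; case: (boolP (onA M v)) => //= ov.
by rewrite -(ruleA_sink ov) /nextA scaleA0; case: (ruleA _).
Qed.

(** * Representations of mixed parity *)

(** One coordinate has a parity different from the two others; in a sum of
    three squares congruent to 1 or 2 modulo 4 this singles out a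
    coordinate. *)
Definition mixed (w : triple) : bool :=
  let: (x, y, z) := w in (Z.odd y == Z.odd z) && (Z.odd x != Z.odd y).

Definition mixed_reps (n : Z) : seq triple := [seq w <- zbox3 n | mixed w && (norm3 w == n)].

Lemma enumerates_mixed_reps n : enumerates (fun w => mixed w && (norm3 w == n)) (mixed_reps n).
Proof.
split; first by rewrite filter_uniq ?zbox3_uniq.
move=> [[x y] z]; rewrite mem_filter; case: (boolP (mixed _ && _)) => [/andP[_ /eqP nw]|//].
by rewrite andTb mem_zbox3; apply/and3P/zrange_norm3; rewrite -nw; apply: Z.le_refl.
Qed.

(** Twice an orthogonal matrix: it multiplies the norm by 4 and carries
    vectors of mixed parity to vectors with four odd coordinates. *)
Definition hadamard (v : quad) : quad :=
  let: (s, (x, y, z)) := v in (s + x + y + z, (s + x - y - z, x + y - s - z, x + z - s - y)).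

Definition quarter_hadamard (v : quad) : quad :=
  let: (s, (x, y, z)) := v in
  ((s + x - y - z) / 4, ((s + x + y + z) / 4, (s + y - x - z) / 4, (s + z - x - y) / 4)).

Definition opp4 (v : quad) : quad := let: (s, (x, y, z)) := v in (- s, (- x, - y, - z)).

Definition mixed4 (M : Z) (v : quad) : bool := mixed v.2 && (norm3 v.2 == M - v.1 * v.1).

(** Of each pair of opposite vectors exactly one has a coordinate sum
    congruent to 1 modulo 4. *)
Definition mixed4_pos (M : Z) (v : quad) : bool := mixed4 M v && one4 (hadamard v).1.

Lemma mixedE x y z : mixed (x, y, z) ->
  exists i j k e, [/\ x = 2 * i + 1 - e, y = 2 * j + e, z = 2 * k + e & e = 0 \/ e = 1].
Proof.
move=> /andP[/eqP yz /eqP xy].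
have ex t : exists i, t = 2 * i + (if Z.odd t then 1 else 0) by exists (Z.div2 t); exact: Z.div2_odd.
have [i ei] := ex x; have [j ej] := ex y; have [k ek] := ex z.
exists i, j, k, (if Z.odd y then 1 else 0); move: xy ei ej ek; rewrite -yz.
by case: (Z.odd x); case: (Z.odd y) => // _ -> -> ->; split; by [Lia.lia | left | right].
Qed.

Lemma mixedI x y z i j k e : x = 2 * i + 1 - e -> y = 2 * j + e -> z = 2 * k + e ->
  e = 0 \/ e = 1 -> mixed (x, y, z).
Proof.
move=> -> -> -> e01; rewrite /mixed.
have od t m : Z.odd (2 * m + t) = Z.odd t by rewrite Z.add_comm Z.odd_add_mul_2.
rewrite !od (_ : 2 * i + 1 - e = 2 * i + (1 - e)) ?od; last by ring.
by case: e01 => ->.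
Qed.

Lemma mixed4_parity M s x y z : Z.odd M -> mixed4 M (s, (x, y, z)) ->
  exists i j k l e, [/\ x = 2 * i + 1 - e, y = 2 * j + e, z = 2 * k + e, s = 2 * l + e & e = 0 \/ e = 1].
Proof.
move=> /Z.odd_spec[m em] /andP[/mixedE[i [j [k [e [ex ey ez e01]]]]] /Z.eqb_eq h].
have [l el] : exists l, s = 2 * l + (if Z.odd s then 1 else 0) by exists (Z.div2 s); exact: Z.div2_odd.
exists i, j, k, l, e; split=> //; move: h el; rewrite /norm3 ex ey ez em /snd /fst.
case: (Z.odd s) => h el; rewrite el in h *; case: e01 => e0; rewrite e0 in h *; Lia.lia.
Qed.

Lemma mixed4_posP M v : Z.odd M -> mixed4_pos M v ->
  (one4_quad (hadamard v) && (norm4 (hadamard v) == 4 * M)) /\ quarter_hadamard (hadamard v) = v.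
Proof.
move: v => [s [[x y] z]] oM /andP[mv o1].
have [i [j [k [l [e [ex ey ez es e01]]]]]] := mixed4_parity oM mv.
have [t et] := one4E o1; have /andP[_ /Z.eqb_eq nv] := mv; split.
  apply/andP; split.
    move: et; rewrite /hadamard /fst => et.
    by apply/and4P; split=> //; [apply: (@one4_is _ (t - j - k - e))|apply: (@one4_is _ (t - l - k - e))|
      apply: (@one4_is _ (t - l - j - e))]; Lia.lia.
  apply/Z.eqb_eq; move: nv; rewrite /norm4 /norm3 /hadamard /fst /snd => nv.
  have -> : M = s * s + (x * x + y * y + z * z) by Lia.lia.
  by ring.
rewrite /quarter_hadamard /hadamard.
by congr (_, (_, _, _)); apply: (@div_unique_exact _ _ _ 0); Lia.lia.
Qed.

Lemma quarter_hadamardP M v : one4_quad v && (norm4 v == 4 * M) ->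
  mixed4_pos M (quarter_hadamard v) /\ hadamard (quarter_hadamard v) = v.
Proof.
move: v => [s [[x y] z]] /andP[/and4P[/one4E[l es] /one4E[i ex] /one4E[j ey] /one4E[k ez]] /Z.eqb_eq nv].
rewrite /quarter_hadamard.
have -> : (s + x - y - z) / 4 = l + i - j - k by apply: (@div_unique_exact _ _ _ 0); Lia.lia.
have -> : (s + x + y + z) / 4 = l + i + j + k + 1 by apply: (@div_unique_exact _ _ _ 0); Lia.lia.
have -> : (s + y - x - z) / 4 = l + j - i - k by apply: (@div_unique_exact _ _ _ 0); Lia.lia.
have -> : (s + z - x - y) / 4 = l + k - i - j by apply: (@div_unique_exact _ _ _ 0); Lia.lia.
split; last by rewrite /hadamard; congr (_, (_, _, _)); Lia.lia.
apply/andP; split; last by apply: (@one4_is _ l); rewrite /hadamard /fst; Lia.lia.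
apply/andP; split; rewrite /fst /snd.
  have pe t : exists u e, t = 2 * u + e /\ (e = 0 \/ e = 1).
    by have [[u eu]|[u eu]] := Z.Even_or_Odd t; [exists u, 0|exists u, 1]; split; by [Lia.lia|left|right].
  have [u [e [eu e01]]] := pe (l + i + j + k).
  by apply: (@mixedI _ _ _ (u + e) (u - i - k) (u - i - j) e) => //; Lia.lia.
apply/Z.eqb_eq; move: nv; rewrite /norm4 /norm3 es ex ey ez; Lia.lia.
Qed.

Lemma opp4K v : opp4 (opp4 v) = v.
Proof. by move: v => [s [[x y] z]]; rewrite /opp4 !Z.opp_involutive. Qed.

Lemma mixed4_opp M v : mixed4 M (opp4 v) = mixed4 M v.
Proof.
move: v => [s [[x y] z]]; rewrite /mixed4 /opp4 /mixed /norm3 /fst /snd !Z.odd_opp.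
by rewrite !Z.mul_opp_opp.
Qed.

(** By the Hadamard matrix half of these quadruples correspond to the
    representations of 4 M by four squares of numbers congruent to 1 modulo 4,
    counted by Jacobi. *)
Lemma size_mixed4 M : 0 < M -> Z.odd M ->
  (\sum_(s <- zrange M) size (mixed_reps (M - s * s)%ZZ))%N = (2 * sigma M)%N.
Proof.
move=> M0 oM; have ep : enumerates (mixed4_pos M) (map quarter_hadamard (reps4 (4 * M))).
  apply: (enumerates_map (g := hadamard) (enumerates_reps4 (4 * M))) => v.
    exact: quarter_hadamardP.
  exact: mixed4_posP.
have hopp v : (hadamard (opp4 v)).1 = - (hadamard v).1.
  by move: v => [s [[x y] z]]; rewrite /hadamard /opp4 /fst; ring.
have hodd v : mixed4 M v -> Z.odd (hadamard v).1.
  move: v => [s [[x y] z]] /(mixed4_parity oM)[i [j [k [l [e [-> -> -> -> _]]]]]].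
  by apply/Z.odd_spec; exists (i + j + k + l + e); rewrite /hadamard /fst; ring.
have em : enumerates (mixed4 M) (map quarter_hadamard (reps4 (4 * M)) ++ map opp4 (map quarter_hadamard (reps4 (4 * M)))).
  apply: (enumerates_double opp4K _ _ ep) => v; rewrite /mixed4_pos mixed4_opp hopp.
    by move=> /andP[mv ov]; rewrite mv one4_opp ?ov //; exact: one4_odd.
  by case: (boolP (mixed4 M v)) => //= mv; rewrite one4_opp ?hodd // orbN.
rewrite mul2n -addnn -(jacobi_four_odd_squares M0 oM) -{1}(size_map quarter_hadamard).
rewrite -[X in (_ + X)%N](size_map quarter_hadamard) -[X in (_ + X)%N](size_map opp4) -size_cat.
symmetry; apply: (size_enumerates_fibers em) => [||s _]; first exact: zrange_uniq.
  move=> s [[x y] z] /andP[_ /Z.eqb_eq]; rewrite /norm3 /fst /snd => h; apply: zrange_sq.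
  by have := Z.square_nonneg x; have := Z.square_nonneg y; have := Z.square_nonneg z; Lia.lia.
exact: enumerates_mixed_reps.
Qed.

(** * Numbers congruent to 1 or 2 modulo 4 *)

Definition neg3 (w : triple) : triple := let: (a, b, c) := w in (- a, - b, - c).

(** The fundamental domain with b = a and b = c kept on the boundary: unlike
    the sinks it is independent of s. *)
Definition reduced_pos (w : triple) : bool :=
  let: (a, b, c) := w in [&& 0 <? a, 0 <? c, - a <? b, b <=? a, - c <? b & b <=? c].

Definition reduced (w : triple) : bool := reduced_pos w || reduced_pos (neg3 w).

Definition sinkA (v : quad) : bool := sinkA_pos v || sinkA_pos (negA v).

(** The correction of the boundary: it preserves the determinant, and on the
    sides b = c and b = - c it exchanges a form that is a sink with one that
    is not. *)
Definition mirror (w : triple) : triple := let: (a, b, c) := w in (- a, b, - c).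

Lemma reduced_sinkA_pos s a b c : Z.odd a -> Z.abs a <> Z.abs b \/ Z.abs b <> Z.abs c ->
  [&& reduced_pos (a, b, c) ==> (sinkA (s, (a, b, c)) || sinkA (s, mirror (a, b, c))),
      reduced_pos (a, b, c) ==> reduced (mirror (a, b, c)) ==> sinkA (s, (a, b, c)),
      sinkA_pos (s, (a, b, c)) ==> (reduced (a, b, c) || reduced (mirror (a, b, c)))
    & sinkA_pos (s, (a, b, c)) ==> sinkA (s, mirror (a, b, c)) ==> reduced (a, b, c)].
Proof.
move=> /Z.odd_spec[i ->] abc.
rewrite /reduced /reduced_pos /neg3 /mirror /sinkA /sinkA_pos /negA.
case: (Z.ltb_spec 0 (2 * i + 1)) => a0; last by [].
have -> : (0 <? - (2 * i + 1)) = false by apply/Z.ltb_nlt; Lia.lia.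
have -> : (0 <? - - (2 * i + 1)) = true by apply/Z.ltb_lt; Lia.lia.
cbn -[Z.add Z.mul Z.opp Z.sub Z.ltb Z.leb Z.eqb].
split_cmp; by [].
Qed.

Lemma neg3K w : neg3 (neg3 w) = w.
Proof. by move: w => [[a b] c]; rewrite /neg3 !Z.opp_involutive. Qed.

Lemma mirrorK w : mirror (mirror w) = w.
Proof. by move: w => [[a b] c]; rewrite /mirror !Z.opp_involutive. Qed.

Lemma negA_pair s w : negA (s, w) = (- s, neg3 w).
Proof. by move: w => [[a b] c]. Qed.

Lemma sinkA_neg v : sinkA (negA v) = sinkA v.
Proof. by rewrite /sinkA negAK orbC. Qed.

Lemma reduced_neg w : reduced (neg3 w) = reduced w.
Proof. by rewrite /reduced neg3K orbC. Qed.

Lemma mirror_neg w : mirror (neg3 w) = neg3 (mirror w).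
Proof. by move: w => [[a b] c]. Qed.

(** Exclusion of the corners |a| = |b| = |c| of the domain, where the exchange
    would fail. *)
Definition generic (w : triple) : Prop :=
  let: (a, b, c) := w in Z.odd a /\ (Z.abs a <> Z.abs b \/ Z.abs b <> Z.abs c).

Lemma generic_neg w : generic w -> generic (neg3 w).
Proof. by move: w => [[a b] c]; rewrite /generic /neg3 !Z.abs_opp Z.odd_opp. Qed.

(** Replacing a form by its mirror image where necessary is therefore a
    bijection between reduced forms and sinks with a given s. *)
Lemma reduced_sinkA s w : generic w ->
  [/\ reduced w -> sinkA (s, w) || sinkA (s, mirror w),
      reduced w -> reduced (mirror w) -> sinkA (s, w),
      sinkA (s, w) -> reduced w || reduced (mirror w)
    & sinkA (s, w) -> sinkA (s, mirror w) -> reduced w].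
Proof.
have pos s' w' : generic w' ->
    [&& reduced_pos w' ==> (sinkA (s', w') || sinkA (s', mirror w')),
      reduced_pos w' ==> reduced (mirror w') ==> sinkA (s', w'),
      sinkA_pos (s', w') ==> (reduced w' || reduced (mirror w'))
    & sinkA_pos (s', w') ==> sinkA (s', mirror w') ==> reduced w'].
  by move: w' => [[a b] c] [oa abc]; exact: reduced_sinkA_pos.
move=> gw; have := pos s w gw; have := pos (- s) (neg3 w) (generic_neg gw).
rewrite mirror_neg -!negA_pair !sinkA_neg !reduced_neg.
move=> /and4P[/implyP h1 /implyP h2 /implyP h3 /implyP h4].
move=> /and4P[/implyP k1 /implyP k2 /implyP k3 /implyP k4]; split.
- by case/orP.
- by case/orP => [/k2|/h2] /implyP.
- by case/orP.
by case/orP => [/k4|/h4] /implyP.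
Qed.

Definition latticeA (n : Z) (w : triple) : bool :=
  let: (a, b, c) := w in [&& Z.odd a, (a - 2 * b - c) mod 4 =? 0 & a * c - b * b == n].

Definition formA (n : Z) (w : triple) : bool := latticeA n w && reduced w.

Lemma latticeAE n a b c : latticeA n (a, b, c) ->
  (exists i j, a = 2 * i + 1 /\ c = 2 * i + 1 - 2 * b - 4 * j) /\ a * c - b * b = n.
Proof.
move=> /and3P[/Z.odd_spec[i ->] /Z.eqb_spec h /eqP ->]; split=> //.
exists i, ((2 * i + 1 - 2 * b - c) / 4).
by have := Z.div_mod (2 * i + 1 - 2 * b - c) 4; rewrite h; Lia.lia.
Qed.

Lemma latticeAI n a b c i j : a = 2 * i + 1 -> c = a - 2 * b - 4 * j -> a * c - b * b = n ->
  latticeA n (a, b, c).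
Proof.
move=> ea ec /eqP e; apply/and3P; split=> //; first by apply/Z.odd_spec; exists i.
by apply/Z.eqb_spec; rewrite (_ : _ - c = j * 4) ?Z.mod_mul //; Lia.lia.
Qed.

Lemma latticeA_mirror n w : latticeA n (mirror w) = latticeA n w.
Proof.
suff H w' : latticeA n w' -> latticeA n (mirror w').
  by apply/idP/idP => /H; rewrite ?mirrorK.
move: w' => [[a b] c] /latticeAE[[i [j [ea ec]]] e].
by apply: (@latticeAI _ _ _ _ (- i - 1) (- j - b)); Lia.lia.
Qed.

Lemma generic_same_sign a b c i j : a = 2 * i + 1 -> c = a - 2 * b - 4 * j ->
  0 < a /\ 0 < c \/ 0 < - a /\ 0 < - c -> generic (a, b, c).
Proof.
move=> ea ec ac; split; first by apply/Z.odd_spec; exists i.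
by Lia.lia.
Qed.

Lemma formA_generic n w : formA n w -> generic w.
Proof.
move: w => [[a b] c] /andP[/latticeAE[[i [j [ea ec]]] _] red].
apply: (generic_same_sign ea (j := j)); first by Lia.lia.
by case/orP: red => /and3P[/Z.ltb_spec0 ? /Z.ltb_spec0 ? _]; [left|right].
Qed.

(** Reduced forms of a given determinant are finite in number. *)
Lemma reduced_bounds a b c n : reduced (a, b, c) -> a * c - b * b = n -> Z.abs a <> Z.abs b \/ Z.abs b <> Z.abs c ->
  0 < n /\ [/\ Z.abs a <= n + 1, Z.abs b <= n + 1 & Z.abs c <= n + 1].
Proof.
suff pos x y z : reduced_pos (x, y, z) -> x * z - y * y = n -> Z.abs x <> Z.abs y \/ Z.abs y <> Z.abs z ->
    0 < n /\ [/\ Z.abs x <= n + 1, Z.abs y <= n + 1 & Z.abs z <= n + 1].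
  case/orP => [|h]; first exact: pos.
  move=> hn; have := pos _ _ _ h; rewrite !Z.abs_opp !Z.mul_opp_opp; exact.
move=> /and5P[/Z.ltb_spec0 x0 /Z.ltb_spec0 z0 /Z.ltb_spec0 y1 /Z.leb_spec0 y2 /andP[/Z.ltb_spec0 y3 /Z.leb_spec0 y4]] <-.
rewrite -[y * y]Z.abs_square => xyz; have {y1 y2}h1 : Z.abs y <= x by Lia.lia.
have {y3 y4}h2 : Z.abs y <= z by Lia.lia.
have := Z.abs_nonneg y; move: xyz h1 h2; rewrite (Z.abs_eq x) ?(Z.abs_eq z); [|Lia.lia|Lia.lia].
move: (Z.abs y) => t xyz tx tz t0; have mono u v : 0 <= u -> t + 1 <= v -> 0 < u -> t <= u -> v <= u * v - t * t + 1.
  by move=> _ tv u0 tu; clear -t0 tv u0 tu; Lia.nia.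
have h3 : 0 < x * z - t * t by clear -x0 z0 xyz tx tz t0; Lia.nia.
split=> //; have [tz'|tx'] : t + 1 <= z \/ t + 1 <= x by Lia.lia.
  have zn := mono x z (Z.lt_le_incl _ _ x0) tz' x0 tx.
  have [?|tx'] : x <= z \/ t + 1 <= x by Lia.lia.
    by split; Lia.lia.
  by have := mono z x (Z.lt_le_incl _ _ z0) tx' z0 tz; split; Lia.lia.
have xn := mono z x (Z.lt_le_incl _ _ z0) tx' z0 tz.
have [?|tz'] : z <= x \/ t + 1 <= z by Lia.lia.
  by split; Lia.lia.
by have := mono x z (Z.lt_le_incl _ _ x0) tz' x0 tx; split; Lia.lia.
Qed.

Definition formsA (n : Z) : seq triple := [seq w <- zbox3 (n + 1) | formA n w].

Lemma formA_bounds n a b c : formA n (a, b, c) ->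
  0 < n /\ [/\ Z.abs a <= n + 1, Z.abs b <= n + 1 & Z.abs c <= n + 1].
Proof.
by move=> f; have /andP[/latticeAE[_ e] red] := f; have [_ g] := formA_generic f; apply: reduced_bounds red e g.
Qed.

Lemma enumerates_formsA n : enumerates (formA n) (formsA n).
Proof.
split; first by rewrite filter_uniq ?zbox3_uniq.
move=> [[a b] c]; rewrite mem_filter; case: (boolP (formA _ _)) => //= f.
have [_ [? ? ?]] := formA_bounds f.
by rewrite mem_zbox3 !mem_zrange; apply/and3P; split; apply/andP; split; apply/Z.leb_spec0; Lia.lia.
Qed.

Definition onsinkA (M : Z) (v : quad) : bool := onA M v && sinkA v.

Lemma sinkA_same_sign s a b c : sinkA (s, (a, b, c)) -> 0 < a /\ 0 < c \/ 0 < - a /\ 0 < - c.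
Proof. by case/orP => /and3P[/Z.ltb_spec0 ? /Z.ltb_spec0 ? _]; [left|right]. Qed.

Lemma onsinkA_disc M s a b c : 0 < M -> onsinkA M (s, (a, b, c)) ->
  0 <= a * c - b * b /\ a * c - b * b = M - s * s.
Proof.
move=> M0 /andP[ov sv]; have := onA_disc ov; rewrite /discA.
have : 0 <= a * c - b * b.
  have pos x y z t : sinkA_pos (t, (x, y, z)) -> 0 <= x * z - y * y.
    by move/sinkA_pos_ge => [x0 z0 yx yz]; have := Z.abs_square y; clear -x0 z0 yx yz; Lia.nia.
  case/orP: sv => /pos //; by rewrite !Z.mul_opp_opp.
by have := Z.square_nonneg s; split; Lia.lia.
Qed.

Definition mirror_unless (P : pred triple) (w : triple) : triple := if P w then w else mirror w.

Lemma onsinkA_lattice M s w : 0 < M -> Z.odd M ->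
  onsinkA M (s, w) = latticeA (M - s * s) w && sinkA (s, w).
Proof.
move: w => [[a b] c] M0 oM; rewrite /onsinkA; case: (boolP (sinkA _)) => [sv|]; last by rewrite !andbF.
rewrite !andbT; apply/idP/idP => [ov|].
  have [_ /eqP e] := @onsinkA_disc M s a b c M0 (introT andP (conj ov sv)).
  by have /and4P[oa _ m4 _] := ov; apply/and3P.
move=> /and3P[oa m4 /eqP e]; apply/and4P; split=> //; last first.
  by apply/Z.eqb_spec; rewrite /discA; Lia.lia.
have [[i [j [ea ec]]] _] : (exists i j, a = 2 * i + 1 /\ c = 2 * i + 1 - 2 * b - 4 * j) /\ a * c - b * b = M - s * s.
  by apply: latticeAE; apply/and3P; split=> //; apply/eqP.
have e3 : (s - b) * (s + b) = M - a * c by Lia.lia.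
have : Z.even ((s - b) * (s + b)).
  rewrite e3 Z.even_sub -!Z.negb_odd oM Z.odd_mul oa ec.
  by rewrite (_ : _ - 4 * j = 1 + 2 * (i - b - 2 * j)) ?Z.odd_add_mul_2 //; ring.
by rewrite Z.even_mul Z.even_sub Z.even_add => /orP[].
Qed.

(** The sinks with a given s are in bijection with a set of reduced forms that
    depends on M - s^2 only, which is what an induction needs. *)
Lemma enumerates_sinkA_fiber M s : 0 < M -> Z.odd M ->
  enumerates (fun w => onsinkA M (s, w))
    (map (mirror_unless (fun w => sinkA (s, w))) (formsA (M - s * s))).
Proof.
move=> M0 oM; set n := M - s * s.
pose f := mirror_unless (fun w => sinkA (s, w)); pose g := mirror_unless reduced.
apply: (enumerates_map (g := g) (enumerates_formsA n)) => [w fw|w].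
  have [h1 h2 _ _] := reduced_sinkA s (formA_generic fw).
  have /andP[lw rw] := fw; rewrite /f /mirror_unless; case: (boolP (sinkA (s, w))) => sw.
    by rewrite onsinkA_lattice // lw sw /g /mirror_unless rw.
  have sm := h1 rw; rewrite (negPf sw) /= in sm.
  rewrite onsinkA_lattice // latticeA_mirror lw sm /g /mirror_unless.
  by case: ifP => [/(h2 rw)|_]; rewrite ?(negPf sw) ?mirrorK.
rewrite onsinkA_lattice // => /andP[lw sw].
have gw : generic w.
  move: w lw sw => [[a b] c] /latticeAE[[i [j [ea ec]]] _] /sinkA_same_sign.
  by apply: (generic_same_sign ea (j := j)); Lia.lia.
have [_ _ h3 h4] := reduced_sinkA s gw.
rewrite /g /mirror_unless; case: (boolP (reduced w)) => rw.
  by rewrite /formA lw rw /f /mirror_unless sw.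
have rm := h3 sw; rewrite (negPf rw) /= in rm.
rewrite /formA latticeA_mirror lw rm /f /mirror_unless; split=> //.
by case: ifP => [/(h4 sw)|_]; rewrite ?(negPf rw) ?mirrorK.
Qed.

(** The class number relation for this family of forms. *)
Lemma size_formsA_sum M : 0 < M -> Z.odd M ->
  (\sum_(s <- zrange M) size (formsA (M - s * s)%ZZ))%N = (2 * sigma M)%N.
Proof.
move=> M0 oM.
have inr s w : onsinkA M (s, w) -> s \in zrange M.
  by move: w => [[a b] c] /(onsinkA_disc M0)[h e]; apply: zrange_sq; Lia.lia.
have eL := enumerates_fibers (zrange_uniq M) inr (fun s _ => enumerates_sinkA_fiber s M0 oM).
rewrite -(size_sinksA M0 oM eL) size_allpairs_dep sumnE big_map.
by apply: eq_bigr => s _; rewrite size_map.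
Qed.

Lemma size_mixed_le0 n : n <= 0 -> size (mixed_reps n) = 0%N.
Proof.
move=> n0; apply/eqP; rewrite size_eq0; case e: (mixed_reps n) => [//|[[x y] z] l].
have [_ m] := enumerates_mixed_reps n.
have := m (x, y, z); rewrite e mem_head => /esym /andP[mw /Z.eqb_eq]; rewrite /norm3.
have [i [j [k [t [ex ey _ t01]]]]] := mixedE mw.
have := Z.square_nonneg x; have := Z.square_nonneg y; have := Z.square_nonneg z.
have [x0|y0] : x <> 0 \/ y <> 0 by Lia.lia.
  by have : 0 < x * x; [clear -x0; Lia.nia|Lia.lia].
by have : 0 < y * y; [clear -y0; Lia.nia|Lia.lia].
Qed.

Lemma size_formsA_le0 n : n <= 0 -> size (formsA n) = 0%N.
Proof.
move=> n0; apply/eqP; rewrite size_eq0; case e: (formsA n) => [//|[[x y] z] l].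
have [_ m] := enumerates_formsA n.
by have := m (x, y, z); rewrite e mem_head => /esym /formA_bounds[]; Lia.lia.
Qed.

Definition one_two_mod4 (n : Z) : Prop := exists k, n = 4 * k + 1 \/ n = 4 * k + 2.

Lemma size_mixed_mod4 n : ~ one_two_mod4 n -> size (mixed_reps n) = 0%N.
Proof.
move=> n0; apply/eqP; rewrite size_eq0; case e: (mixed_reps n) => [//|[[x y] z] l].
have [_ m] := enumerates_mixed_reps n; case: n0.
have := m (x, y, z); rewrite e mem_head => /esym /andP[mw /Z.eqb_eq <-]; rewrite /norm3.
have [i [j [k [t [-> -> -> [->|->]]]]]] := mixedE mw.
  by exists (i * i + i + j * j + k * k); left; ring.
by exists (i * i + j * j + j + k * k + k); right; ring.
Qed.

Lemma size_formsA_mod4 n : ~ one_two_mod4 n -> size (formsA n) = 0%N.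
Proof.
move=> n0; apply/eqP; rewrite size_eq0; case e: (formsA n) => [//|[[a b] c] l].
have [_ m] := enumerates_formsA n; case: n0.
have := m (a, b, c); rewrite e mem_head => /esym /andP[/latticeAE[[i [j [-> ->]]] <-] _].
have [[k ->]|[k ->]] := Z.Even_or_Odd b.
  by exists (i * i + i - k * (2 * i + 1) - j * (2 * i + 1) - k * k); left; ring.
by exists (i * i - 2 * k * i - k - j * (2 * i + 1) - k * k - k - 1); right; ring.
Qed.

(** Both sides vanish unless n is congruent to 1 or 2 modulo 4. Then induction
    on n with the class number relation at M = n or M = n + 1, whichever is
    odd: the terms with M - s^2 = n are those with s = 0, or with s = 1 and s
    = - 1; all others have smaller arguments, or vanish because M is congruent
    to 3 modulo 4. *)
Lemma size_mixed_formsA n : size (mixed_reps n) = size (formsA n).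
Proof.
suff H : forall n, 0 <= n -> size (mixed_reps n) = size (formsA n).
  by have [?|?] := Z.le_gt_cases 0 n; [apply: H|rewrite size_mixed_le0 ?size_formsA_le0 //; Lia.lia].
clear n; apply: zdescent => n IH n0.
have low m : m < n -> size (mixed_reps m) = size (formsA m).
  by move=> mn; have [?|?] := Z.le_gt_cases 0 m; [apply: IH|rewrite size_mixed_le0 ?size_formsA_le0 //; Lia.lia].
have sums M : 0 < M -> Z.odd M -> (\sum_(s <- zrange M) size (mixed_reps (M - s * s)%ZZ) =
    \sum_(s <- zrange M) size (formsA (M - s * s)%ZZ))%N.
  by move=> M0 oM; rewrite size_mixed4 // size_formsA_sum.
have [[k [ek|ek]]|no] : one_two_mod4 n \/ ~ one_two_mod4 n.
- rewrite /one_two_mod4; have := Z.div_mod n 4; have := Z.mod_pos_bound n 4 => h1 h2.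
  have [?|[?|[?|?]]] : n mod 4 = 0 \/ n mod 4 = 1 \/ n mod 4 = 2 \/ n mod 4 = 3 by Lia.lia.
  + by right=> -[k ?]; Lia.lia.
  + by left; exists (n / 4); Lia.lia.
  + by left; exists (n / 4); Lia.lia.
  by right=> -[k ?]; Lia.lia.
- have on : Z.odd n by apply/Z.odd_spec; exists (2 * k); Lia.lia.
  have m0 : 0 \in zrange n by rewrite mem_zrange; apply/andP; split; apply/Z.leb_spec0; Lia.lia.
  have n1 : 0 < n by Lia.lia.
  have := sums n n1 on; rewrite !(bigD1_seq (0 : Z)) ?zrange_uniq //.
  have -> : (\sum_(s <- zrange n | s != 0%ZZ) size (mixed_reps (n - s * s)%ZZ) =
      \sum_(s <- zrange n | s != 0%ZZ) size (formsA (n - s * s)%ZZ))%N.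
    by apply: eq_bigr => s /eqP s0; apply: low; clear -s0; Lia.nia.
  by rewrite Z.mul_0_r Z.sub_0_r => /addIn.
- have on : Z.odd (n + 1) by apply/Z.odd_spec; exists (2 * k + 1); Lia.lia.
  have m1 : 1 \in zrange (n + 1) by rewrite mem_zrange; apply/andP; split; apply/Z.leb_spec0; Lia.lia.
  have n1 : 0 < n + 1 by Lia.lia.
  pose u (s : Z) := s * s == 1.
  have := sums (n + 1) n1 on; rewrite (bigID u) [RHS](bigID u).
  have -> : (\sum_(s <- zrange (n + 1) | ~~ u s) size (mixed_reps (n + 1 - s * s)%ZZ) =
      \sum_(s <- zrange (n + 1) | ~~ u s) size (formsA (n + 1 - s * s)%ZZ))%N.
    apply: eq_bigr => s /eqP s1; have [->|s0] := Z.eq_dec s 0.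
      have no : ~ one_two_mod4 (n + 1 - 0 * 0) by move=> [j]; Lia.lia.
      by rewrite size_mixed_mod4 ?size_formsA_mod4.
    by apply: low; clear -s0 s1; Lia.nia.
  have const (F : Z -> nat) : (\sum_(s <- zrange (n + 1) | u s) F (n + 1 - s * s)%ZZ =
      count u (zrange (n + 1)) * F n)%N.
    rewrite -sum1_count big_distrl /=; apply: eq_bigr => s /eqP ->.
    by rewrite mul1n Z.add_simpl_r.
  move/addIn; rewrite (const (size \o mixed_reps)) (const (size \o formsA)) => /eqP.
  rewrite eqn_pmul2l => [/eqP //|]; rewrite -has_count; apply/hasP.
  by exists (1 : Z).
by rewrite size_mixed_mod4 ?size_formsA_mod4.
Qed.

(** The forms (1, 0, n) and (1, 1, n + 1) are reduced of determinant n, so the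
    equinumerous set of representations is not empty. *)
Lemma three_squares_mod4 n : 0 < n -> one_two_mod4 n ->
  exists x y z : Z, n = x * x + y * y + z * z.
Proof.
move=> n0 nk; have h := size_mixed_formsA n.
have [w wn] : exists w, w \in formsA n.
  have [_ m] := enumerates_formsA n.
  have red b m' : 0 <= b < m' -> b <= 1 -> reduced (1, b, m').
    move=> ? ?; apply/orP; left; apply/and5P.
    by split; [| | | |apply/andP; split]; first [apply/Z.ltb_spec0|apply/Z.leb_spec0]; Lia.lia.
  case: nk => k [ek|ek].
    exists (1, 0, n); rewrite m; apply/andP; split; last by apply: red; Lia.lia.
    by apply: (@latticeAI _ _ _ _ 0 (- k)); Lia.lia.
  exists (1, 1, n + 1); rewrite m; apply/andP; split; last by apply: red; Lia.lia.
  by apply: (@latticeAI _ _ _ _ 0 (- k - 1)); Lia.lia.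
case: (formsA n) h wn => // w' l; have [_ m] := enumerates_mixed_reps n.
case: (mixed_reps n) m => // -[[x y] z] l' /(_ (x, y, z)); rewrite mem_head => /esym /andP[_ /Z.eqb_eq e] _ _.
by exists x, y, z; rewrite -e.
Qed.

(** * A large power with a small remainder *)

Definition three_squares (m : Z) : Prop := exists x y z : Z, m = x * x + y * y + z * z.

Lemma three_squares_scale g m : three_squares m -> three_squares (g * g * m).
Proof. by move=> [x [y [z ->]]]; exists (g * x), (g * y), (g * z); ring. Qed.

Lemma three_squares_mod8 y x : 0 <= 8 * y + x -> x = 1 \/ x = 2 \/ x = 3 \/ x = 5 \/ x = 6 ->
  three_squares (8 * y + x).
Proof.
move=> m0 [e|[e|[e|[e|e]]]]; rewrite e in m0 *.
- by apply: three_squares_mod4; [Lia.lia|exists (2 * y); Lia.lia].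
- by apply: three_squares_mod4; [Lia.lia|exists (2 * y); Lia.lia].
- have [| |a [b [c h]]] := @three_odd_squares (2 * y + 1).
  + by Lia.lia.
  + by apply/Z.odd_spec; exists y.
  + by exists a, b, c; rewrite -h; ring.
- by apply: three_squares_mod4; [Lia.lia|exists (2 * y + 1); Lia.lia].
by apply: three_squares_mod4; [Lia.lia|exists (2 * y + 1); Lia.lia].
Qed.

Definition two_or_three (h : Z) : Prop := h = 2 \/ h = 3.

(** The shape of the numbers c (8 y + x) that are not divisible by 4^h: c is
    the power of 4 and x the residue modulo 8 of the cofactor. *)
Definition reduced_power4 (h c x : Z) : Prop :=
  (c = 1 \/ c = 4 \/ c = 16 /\ h = 3) /\
  (x = 1 \/ x = 2 \/ x = 3 \/ x = 5 \/ x = 6 \/ x = 7).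

Lemma extract_power h m : two_or_three h -> 0 < m ->
  exists g c x y, [/\ 0 < g, reduced_power4 h c x & m = (g ^ h) * (g ^ h) * (c * (8 * y + x))].
Proof.
move=> h23 m0; have {m0} : 0 <= m /\ 0 < m by Lia.lia.
case; move: m; apply: zdescent => m IH _ m0.
have := Z.div_mod m 8; have := Z.mod_pos_bound m 8 => b8 e8.
have [m4|m4] : (m mod 8 = 0 \/ m mod 8 = 4) \/ (m mod 8 <> 0 /\ m mod 8 <> 4) by Lia.lia.
  have [m' em] : exists m', m = 4 * m'.
    by case: m4 => e; [exists (2 * (m / 8))|exists (2 * (m / 8) + 1)]; Lia.lia.
  have [| |g [c [x [y [g0 [cc xx] em']]]]] := IH m'; [by Lia.lia|by Lia.lia|].
  have pow2 : (2 * g) ^ h = 2 ^ h * g ^ h by rewrite Z.pow_mul_l.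
  case: (cc) => [ec|cc'].
    exists g, 4, x, y; split=> //; first by split=> //; right; left.
    by rewrite em em' ec; ring.
  have [ec|ec] : (c = 4 /\ h = 3) \/ ~ (c = 4 /\ h = 3) by Lia.lia.
    case: ec => ec h3; exists g, 16, x, y; split=> //; first by split=> //; right; right.
    by rewrite em em' ec; ring.
  (* One more factor 4 completes a power 4^h = 2^h 2^h. *)
  exists (2 * g), 1, x, y; split; [by Lia.lia|by split=> //; left|].
  rewrite pow2 em em'; case: h23 => eh.
    have -> : c = 4 by Lia.lia.
    by rewrite eh; ring.
  have -> : c = 16 by Lia.lia.
  by rewrite eh; ring.
exists 1, 1, (m mod 8), (m / 8); split; [by []| |].
  by split; [left|Lia.lia].
by rewrite Z.pow_1_l; [Lia.lia|case: h23; Lia.lia].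
Qed.

Lemma pow_even_quarter h i : two_or_three h -> exists q, (4 * i) ^ h = 16 * q.
Proof.
by case=> ->; [exists (i * i)|exists (4 * i * i * i)]; ring.
Qed.

Lemma odd_pow h u : two_or_three h -> Z.odd u -> Z.odd (u ^ h).
Proof. by case=> -> ou; rewrite Z.odd_pow. Qed.

(** The root is a multiple of 4 unless the cofactor 8 y + x is 7 modulo 8, or
    is odd with c = 4; then it is odd, or twice an odd number if c = 16. The
    difference is, up to a power of 4, congruent to 1, 2, 3, 5 or 6 modulo
    8. *)
Lemma good_residue h c x y : two_or_three h -> reduced_power4 h c x ->
  exists2 r, 0 <= r < 4 & forall j, let P := (4 * j + r) ^ h in
    P * P <= c * (8 * y + x) -> three_squares (c * (8 * y + x) - P * P).
Proof.
move=> h23 [cc xx].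
have odd_root j : exists w, (4 * j + 1) ^ h * (4 * j + 1) ^ h = 8 * w + 1.
  by apply/odd_sq_mod8/odd_pow/Z.odd_spec => //; exists (2 * j); ring.
have four u : three_squares u -> three_squares (4 * u) by exact: (@three_squares_scale 2).
case: cc => [->|[->|[-> h3]]].
- have [e|x7] := Z.eq_dec x 7.
    exists 1 => // j P; have [w ->] := odd_root j => le.
    rewrite (_ : _ - _ = 8 * (y - w) + 6); last by rewrite e; ring.
    by apply: three_squares_mod8; Lia.lia.
  exists 0 => // j P; rewrite /P Z.add_0_r; have [q ->] := pow_even_quarter j h23 => le.
  rewrite (_ : _ - _ = 8 * (y - 32 * q * q) + x); last by ring.
  by apply: three_squares_mod8; Lia.lia.
- have [e|ox] : (x = 2 \/ x = 6) \/ exists z, x = 2 * z + 1.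
    by case: xx => [|[|[|[|[]]]]] e; [right; exists 0|left|right; exists 1|right; exists 2|left|right; exists 3]; Lia.lia.
    exists 0 => // j P; rewrite /P Z.add_0_r; have [q ->] := pow_even_quarter j h23 => le.
    rewrite (_ : _ - _ = 4 * (8 * (y - 8 * q * q) + x)); last by ring.
    by apply/four/three_squares_mod8; Lia.lia.
  case: ox => z ex; exists 1 => // j P; have [w ->] := odd_root j => le.
  rewrite (_ : _ - _ = 8 * (4 * y + z - w) + 3); last by rewrite ex; ring.
  by apply: three_squares_mod8; Lia.lia.
have [e|x7] := Z.eq_dec x 7.
  exists 2 => // j P; have -> : P = 8 * (2 * j + 1) ^ h by rewrite /P h3; ring.
  have [w ew] : exists w, (2 * j + 1) ^ h * (2 * j + 1) ^ h = 8 * w + 1.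
    by apply/odd_sq_mod8/odd_pow/Z.odd_spec => //; exists j.
  rewrite (_ : 8 * _ * _ = 64 * (8 * w + 1)); last by rewrite -ew; ring.
  move=> le; rewrite (_ : _ - _ = 4 * (4 * (8 * (y - 4 * w) + 3))); last by rewrite e; ring.
  by apply/four/four/three_squares_mod8; Lia.lia.
exists 0 => // j P; have -> : P = 64 * (j * j * j) by rewrite /P h3; ring.
set q := j * j * j => le; rewrite (_ : _ - _ = 4 * (4 * (8 * (y - 32 * q * q) + x))); last by ring.
by apply/four/four/three_squares_mod8; Lia.lia.
Qed.

Lemma last_below (P : Z -> bool) (b : Z) : 0 <= b -> P 0 -> ~~ P b ->
  exists j, [/\ 0 <= j, P j & ~~ P (j + 1)].
Proof.
move=> b0 P0; move: b b0; apply: zdescent => b IH b0 nb.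
have b1 : b <> 0 by move=> e; rewrite e P0 in nb.
case: (boolP (P (b - 1))) => [Pb|/IH]; last by apply; Lia.lia.
by exists (b - 1); split; rewrite ?Z.sub_add //; Lia.lia.
Qed.

(** Bernoulli: (1 - 4 / w)^(2 h) >= 1 - 8 h / w, where 8 h <= 24. *)
Lemma pow_gap h n w : two_or_three h -> 0 <= n -> 24 * (n + 1) <= w ->
  n * (w ^ h * w ^ h) <= (n + 1) * ((w - 4) ^ h * (w - 4) ^ h).
Proof.
case=> -> n0 wn.
  have -> : (w - 4) ^ 2 * (w - 4) ^ 2 = w * w * w * (w - 24) + (8 * w * w * w + 96 * w * w - 256 * w + 256) by ring.
  have p : 0 <= 8 * w * w * w + 96 * w * w - 256 * w + 256 by clear -n0 wn; Lia.nia.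
  have q : n * (w ^ 2 * w ^ 2) <= (n + 1) * (w * w * w * (w - 24)).
    have -> : n * (w ^ 2 * w ^ 2) = w * w * w * (n * w) by ring.
    have -> : (n + 1) * (w * w * w * (w - 24)) = w * w * w * ((n + 1) * (w - 24)) by ring.
    by apply: Z.mul_le_mono_nonneg_l; [have : 0 < w * w * w by clear -n0 wn; Lia.nia|]; Lia.lia.
  by clear -n0 p q; Lia.nia.
have -> : (w - 4) ^ 3 * (w - 4) ^ 3 = w * w * w * w * w * (w - 24) +
    (80 * w * w * w * (3 * w - 16) + 768 * w * (5 * w - 8) + 4096) by ring.
have w3 : 0 < w * w * w by clear -n0 wn; Lia.nia.
have p : 0 <= 80 * w * w * w * (3 * w - 16) + 768 * w * (5 * w - 8) + 4096.
  have : 0 <= w * w * w * (3 * w - 16) by apply: Z.mul_nonneg_nonneg; Lia.lia.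
  have : 0 <= w * (5 * w - 8) by apply: Z.mul_nonneg_nonneg; Lia.lia.
  by clear; Lia.lia.
have q : n * (w ^ 3 * w ^ 3) <= (n + 1) * (w * w * w * w * w * (w - 24)).
  have -> : n * (w ^ 3 * w ^ 3) = w * w * w * w * w * (n * w) by ring.
  have -> : (n + 1) * (w * w * w * w * w * (w - 24)) = w * w * w * w * w * ((n + 1) * (w - 24)) by ring.
  apply: Z.mul_le_mono_nonneg_l; last by Lia.lia.
  by have : 0 < (w * w * w) * (w * w) by [clear -w3 n0 wn; Lia.nia|]; Lia.lia.
by clear -n0 p q; Lia.nia.
Qed.

(** The root t = g s combines the extracted g with a large s in a suitable
    class modulo 4. Consecutive candidates s and s + 4 have nearly equal
    powers because s + 4 > k, and M lies between these powers up to the factor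
    coming from g. *)
Lemma close_power h n m : two_or_three h -> 0 <= n -> 0 < m ->
  let k := 24 * (n + 1) + 1 in let M := m * (k ^ h * k ^ h) in
  exists t, [/\ 0 <= t, three_squares (M - t ^ h * t ^ h) & n * M <= (n + 1) * (t ^ h * t ^ h)].
Proof.
move=> h23 n0 m0 k M; have h0 : 0 < h by case: h23; Lia.lia.
have [g [c [x [y [g0 red em]]]]] := extract_power h23 m0.
have ok : Z.odd k by apply/Z.odd_spec; exists (12 * (n + 1)); rewrite /k; ring.
have [v ev] := odd_sq_mod8 (odd_pow h23 ok).
(* Multiplication by the odd square 8 v + 1 preserves the residue x modulo 8
   and the power of 4. *)
pose y' := y + v * x + 8 * v * y.
have eM : M = g ^ h * g ^ h * (c * (8 * y' + x)).
  by rewrite /M em ev /y'; ring.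
set M1 := c * (8 * y' + x) in eM.
have g1 : 0 < g ^ h * g ^ h by apply: Z.mul_pos_pos; apply: Z.pow_pos_nonneg; Lia.lia.
have kM1 : k ^ h * k ^ h <= M1.
  have -> : M1 = c * (8 * y + x) * (k ^ h * k ^ h) by rewrite ev /M1 /y'; ring.
  have : 0 < c * (8 * y + x) by move: m0; rewrite em; clear -g1; Lia.nia.
  have : 0 < k ^ h * k ^ h by rewrite ev; have := Z.square_nonneg (k ^ h); rewrite ev; Lia.lia.
  by clear; Lia.nia.
have [r r4 good] := good_residue y' h23 red.
have mono a b : 0 <= a -> a <= b -> a ^ h * a ^ h <= b ^ h * b ^ h.
  move=> a0 ab; have := Z.pow_le_mono_l a b h (conj a0 ab); have := Z.pow_nonneg a h a0.
  by clear; Lia.nia.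
pose P j := (4 * j + r) ^ h * (4 * j + r) ^ h <=? M1.
have M10 : 0 <= M1 by have := Z.square_nonneg (k ^ h); Lia.lia.
have [| |j [j0 /Z.leb_spec0 Pj nPj]] := @last_below P (M1 + 1) (Z.le_trans _ _ _ M10 (Z.le_succ_diag_r _)).
- apply/Z.leb_spec0; apply: Z.le_trans kM1; apply: mono; rewrite /k; Lia.lia.
- apply/negP => /Z.leb_spec0 le; have := mono (M1 + 1) (4 * (M1 + 1) + r).
  have e : M1 + 1 <= (M1 + 1) ^ h * (M1 + 1) ^ h.
    have H : M1 + 1 <= (M1 + 1) ^ h.
      by rewrite -{1}(Z.pow_1_r (M1 + 1)); apply: Z.pow_le_mono_r; Lia.lia.
    by clear -M10 H; Lia.nia.
  by Lia.lia.
pose s := 4 * j + r; have s0 : 0 <= s by rewrite /s; Lia.lia.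
have sk : k < s + 4.
  apply/Z.lt_nge => sk; move/negP: nPj; apply; apply/Z.leb_spec0; apply: Z.le_trans kM1.
  by apply: mono; rewrite /s in sk s0; Lia.lia.
have big : M1 < (s + 4) ^ h * (s + 4) ^ h.
  by move: nPj; rewrite /P (_ : 4 * (j + 1) + r = s + 4) => [/Z.leb_spec0|]; rewrite /s; Lia.lia.
have gap := @pow_gap h n (s + 4) h23 n0; rewrite Z.add_simpl_r in gap.
exists (g * s); rewrite Z.pow_mul_l; split; first by Lia.nia.
  rewrite eM (_ : _ - _ = g ^ h * g ^ h * (M1 - s ^ h * s ^ h)); last by ring.
  apply: (three_squares_scale (g ^ h)); exact: good Pj.
rewrite eM (_ : n * _ = g ^ h * g ^ h * (n * M1)); last by ring.
rewrite (_ : (n + 1) * _ = g ^ h * g ^ h * ((n + 1) * (s ^ h * s ^ h))); last by ring.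
apply: Z.mul_le_mono_nonneg_l; first by Lia.lia.
apply: Z.le_trans (gap _); last by rewrite /k in sk; Lia.lia.
by apply: Z.mul_le_mono_nonneg_l; Lia.lia.
Qed.

(** * Integral representations *)

Lemma cauchy_schwarz3 b c d p q u :
  (b * p + c * q + d * u) * (b * p + c * q + d * u) <=
  (b * b + c * c + d * d) * (p * p + q * q + u * u).
Proof.
have := Z.square_nonneg (b * q - c * p); have := Z.square_nonneg (b * u - d * p).
by have := Z.square_nonneg (c * u - d * q); Lia.lia.
Qed.

(** The perturbation has absolute value at most s, so for a >= 1 it does not
    change the sign of a s; for a = 0 the factor a makes the sign
    irrelevant. *)
Lemma small_perturbation n a b c d p q u s : 0 <= a -> 0 <= s ->
  b * b + c * c + d * d <= n -> n * (p * p + q * q + u * u) <= s * s ->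
  a * Z.abs (a * s + (b * p + c * q + d * u)) = a * (a * s + (b * p + c * q + d * u)).
Proof.
move=> a0 s0 bn ns; have [->|a1] := Z.eq_dec a 0; first by rewrite !Z.mul_0_l.
have := @cauchy_schwarz3 b c d p q u; set e := b * p + c * q + d * u => h.
have N0 : 0 <= p * p + q * q + u * u.
  by have := Z.square_nonneg p; have := Z.square_nonneg q; have := Z.square_nonneg u; Lia.lia.
have le : e * e <= s * s by clear -bn ns h N0; Lia.nia.
have : Z.abs e <= s by clear -le s0; Lia.nia.
by move=> es; rewrite Z.abs_eq //; clear -es a0 a1 s0; Lia.nia.
Qed.

(** The absolute values of the coordinates of the quaternion product of (A, B,
    C, D) by (t^h, p, q, u). *)
Lemma integral_representation h A B C D r : two_or_three h ->
  0 <= A -> 0 <= B -> 0 <= C -> 0 <= D -> 0 <= r ->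
  let n := A * A + B * B + C * C + D * D in let k := 24 * (n + 1) + 1 in let N := n * k ^ h in
  0 < n -> exists x y z w t, [/\ 0 <= x /\ 0 <= y, 0 <= z /\ 0 <= w, 0 <= t,
    x * x + y * y + z * z + w * w = r * (N * N) & A * x + B * y + C * z + D * w = n * t ^ h].
Proof.
move=> h23 A0 B0 C0 D0 r0 n k N n0.
have [->|rn] := Z.eq_dec r 0.
  exists 0, 0, 0, 0, 0; split=> //.
  by rewrite Z.pow_0_l; [rewrite !Z.mul_0_r|case: h23; Lia.lia].
have n0' : 0 <= n by Lia.lia.
have m0 : 0 < n * r by clear -n0 r0 rn; Lia.nia.
have [t [t0 [p [q [u e]]]]] := @close_power h n (n * r) h23 n0' m0; rewrite -/k.
set s := t ^ h in e *; set K := k ^ h in e N * => close.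
have s0 : 0 <= s by apply: Z.pow_nonneg.
have {}e : n * r * (K * K) - s * s = p * p + q * q + u * u by exact: e.
have {}close : n * (n * r * (K * K)) <= (n + 1) * (s * s) by exact: close.
have ns : n * (p * p + q * q + u * u) <= s * s by rewrite -e; Lia.lia.
have sq a b c d : a * a + b * b + c * c + d * d = n -> b * b + c * c + d * d <= n.
  by have := Z.square_nonneg a; Lia.lia.
exists (Z.abs (A * s + (- B * p + - C * q + - D * u))), (Z.abs (B * s + (A * p + - D * q + C * u))),
  (Z.abs (C * s + (D * p + A * q + - B * u))), (Z.abs (D * s + (- C * p + B * q + A * u))), t.
split; [by split; exact: Z.abs_nonneg|by split; exact: Z.abs_nonneg|by []| |].
  rewrite !Z.abs_square (_ : _ + _ = n * (s * s + (p * p + q * q + u * u))); last by rewrite /n; ring.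
  by rewrite -e /N; ring.
rewrite (@small_perturbation n A (- B) (- C) (- D) p q u s) //; last by apply: (sq A); rewrite /n; ring.
rewrite (@small_perturbation n B A (- D) C p q u s) //; last by apply: (sq B); rewrite /n; ring.
rewrite (@small_perturbation n C D A (- B) p q u s) //; last by apply: (sq C); rewrite /n; ring.
rewrite (@small_perturbation n D (- C) B A p q u s) //; last by apply: (sq D); rewrite /n; ring.
by rewrite -/s /n; ring.
Qed.

Local Close Scope Z_scope.
Lemma natural_representation (h A B C D r : nat) : h = 2%N \/ h = 3%N ->
  let n := (A * A + B * B + C * C + D * D)%N in let k := (24 * n.+1).+1 in
  let N := (n * k ^ h)%N in (0 < n)%N ->
  exists x y z w t, (x * x + y * y + z * z + w * w = r * (N * N))%N /\
    (A * x + B * y + C * z + D * w = n * t ^ h)%N.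
Proof.
move=> h23 n k N n0.
have toZ (m : nat) : (0 <= Z.of_nat m)%ZZ by apply: Nat2Z.is_nonneg.
have h23' : two_or_three (Z.of_nat h) by case: h23 => ->; [left|right].
have nE : Z.of_nat n = (Z.of_nat A * Z.of_nat A + Z.of_nat B * Z.of_nat B +
    Z.of_nat C * Z.of_nat C + Z.of_nat D * Z.of_nat D)%ZZ.
  by rewrite /n -!multE -!plusE !(Nat2Z.inj_add, Nat2Z.inj_mul).
have powE u : Z.of_nat (u ^ h) = (Z.of_nat u ^ Z.of_nat h)%ZZ.
  by case: h23 => ->; rewrite !expnS expn0 muln1 -!multE !Nat2Z.inj_mul //; Lia.lia.
have kE : Z.of_nat k = (24 * (Z.of_nat n + 1) + 1)%ZZ by rewrite /k; lia.
have rep := @integral_representation (Z.of_nat h) _ _ _ _ (Z.of_nat r) h23' (toZ A) (toZ B) (toZ C) (toZ D) (toZ r).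
cbv zeta in rep; rewrite -nE -kE -powE in rep; case: rep => [|x [y [z [w [t [[x0 y0] [z0 w0] t0 e1 e2]]]]]]; first lia.
exists (Z.to_nat x), (Z.to_nat y), (Z.to_nat z), (Z.to_nat w), (Z.to_nat t).
split; apply: Nat2Z.inj; rewrite -!multE -!plusE !(Nat2Z.inj_add, Nat2Z.inj_mul) ?powE !Z2Nat.id //.
  by rewrite e1 nE powE.
by rewrite e2 nE.
Qed.

From mathcomp Require Import ring.
Local Open Scope ring_scope.

(** * Clearing denominators *)

Lemma nonneg_rat_frac (q : rat) : 0 <= q -> exists n m : nat, (0 < m)%N /\ q = n%:R / m%:R.
Proof.
move=> q0; exists `|numq q|%N, `|denq q|%N; split; first by rewrite absz_gt0 denq_neq0.
rewrite -{1}[q]divq_num_den -[in LHS](gez0_abs (_ : 0 <= numq q)) ?numq_ge0 //.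
by rewrite -[in LHS](gez0_abs (_ : 0 <= denq q)) ?denq_ge0.
Qed.

Lemma natr_neq0 (m : nat) : (0 < m)%N -> (m%:R : rat) != 0.
Proof. by move=> m0; rewrite pnatr_eq0 -lt0n. Qed.

(** A sixth power is both a square and a cube, so dividing by this denominator
    does not affect being an h-th power. *)
Lemma common_sixth_power_den (a b c d : rat) : 0 <= a -> 0 <= b -> 0 <= c -> 0 <= d ->
  exists A B C E m : nat, [/\ (0 < m)%N, a = A%:R / m%:R ^+ 6, b = B%:R / m%:R ^+ 6,
    c = C%:R / m%:R ^+ 6 & d = E%:R / m%:R ^+ 6].
Proof.
move=> /nonneg_rat_frac[a1 [a2 [a20 ->]]] /nonneg_rat_frac[b1 [b2 [b20 ->]]].
move=> /nonneg_rat_frac[c1 [c2 [c20 ->]]] /nonneg_rat_frac[d1 [d2 [d20 ->]]].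
pose m := (a2 * b2 * c2 * d2)%N.
exists (a1 * (b2 * c2 * d2) * m ^ 5)%N, (b1 * (a2 * c2 * d2) * m ^ 5)%N,
  (c1 * (a2 * b2 * d2) * m ^ 5)%N, (d1 * (a2 * b2 * c2) * m ^ 5)%N, m.
rewrite /m !muln_gt0 a20 b20 c20 d20 !(natrM, natrX).
by split=> //; field; rewrite !natr_neq0.
Qed.

Lemma rat_power_div (h : nat) (p q : rat) : is_rat_power h p -> is_rat_power h q -> is_rat_power h (p / q).
Proof. by move=> [s ->] [t ->]; exists (s / t); rewrite exprMn exprVn. Qed.

Lemma is_rat_power_exp (h : nat) (p : rat) : is_rat_power h (p ^+ h).
Proof. by exists p. Qed.

Definition scale_den (A B C E h : nat) : nat :=
  let n := (A * A + B * B + C * C + E * E)%N in (n * (24 * n.+1).+1 ^ h)%N.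

Lemma natural_coefficients (A B C E : nat) :
  (0 < A * A + B * B + C * C + E * E)%N ->
  forall h : nat, h = 2%N \/ h = 3%N -> forall r : nat, exists x y z w : nat,
    let N := scale_den A B C E h in
    r%:R = (x%:R / N%:R) ^+ 2 + (y%:R / N%:R) ^+ 2 + (z%:R / N%:R) ^+ 2 + (w%:R / N%:R) ^+ 2 :> rat /\
    is_rat_power h (A%:R * (x%:R / N%:R) + B%:R * (y%:R / N%:R) + C%:R * (z%:R / N%:R) + E%:R * (w%:R / N%:R)).
Proof.
move=> n0 h h23 r; have [x [y [z [w [t [e1 e2]]]]]] := natural_representation r h23 n0.
exists x, y, z, w => N; have N0 : (N%:R : rat) != 0.
  by apply: natr_neq0; rewrite /N /scale_den muln_gt0 n0 expn_gt0.
split.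
  apply: (mulIf (expf_neq0 2 N0)); rewrite !mulrDl !expr_div_n !divfK ?expf_neq0 //.
  by rewrite -!natrX -!natrM -!natrD -!mulnn -/N e1 /N /scale_den.
exists (t%:R / (24 * (A * A + B * B + C * C + E * E).+1).+1%:R).
rewrite !mulrA -!mulrDl -!natrM -!natrD e2 natrM natrX /N /scale_den natrM natrX expr_div_n.
by rewrite -mulf_div divff ?mul1r ?natr_neq0.
Qed.

(** When all coefficients vanish any representation of r will do, and the one
    for the coefficients (1, 0, 0, 0) is taken. *)
Lemma natural_coefficients_any (A B C E : nat) :
  exists2 N : nat -> nat, (forall h, 0 < N h)%N &
  forall h : nat, h = 2%N \/ h = 3%N -> forall r : nat, exists x y z w : nat,
    r%:R = (x%:R / (N h)%:R) ^+ 2 + (y%:R / (N h)%:R) ^+ 2 + (z%:R / (N h)%:R) ^+ 2 + (w%:R / (N h)%:R) ^+ 2 :> rat /\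
    is_rat_power h (A%:R * (x%:R / (N h)%:R) + B%:R * (y%:R / (N h)%:R) + C%:R * (z%:R / (N h)%:R) + E%:R * (w%:R / (N h)%:R)).
Proof.
have pos A' B' C' E' h : (0 < A' * A' + B' * B' + C' * C' + E' * E')%N -> (0 < scale_den A' B' C' E' h)%N.
  by move=> n0; rewrite /scale_den muln_gt0 n0 expn_gt0.
have [n0|n0] := posnP (A * A + B * B + C * C + E * E)%N.
  exists (scale_den 1 0 0 0) => [h|h h23 r]; first exact: pos.
  have [x [y [z [w [e _]]]]] := @natural_coefficients 1 0 0 0 isT h h23 r.
  exists x, y, z, w; split=> //.
  move/eqP: n0; rewrite !addn_eq0 !muln_eq0 !orbb => /andP[/andP[/andP[/eqP -> /eqP ->] /eqP ->] /eqP ->].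
  by rewrite !mul0r !addr0; case: h23 => ->; exists 0; rewrite expr0n.
exists (scale_den A B C E) => [h|h h23 r]; first exact: pos.
exact: (natural_coefficients n0 h23 r).
Qed.

Lemma in_nat_over_mulr (N M k : nat) : (0 < N)%N -> (0 < M)%N -> in_nat_over (N * M) (k%:R / N%:R).
Proof.
move=> N0 M0; exists (k * M)%N; rewrite !natrM.
by field; rewrite !natr_neq0.
Qed.

Lemma in_nat_over_ge0 (N : nat) (q : rat) : in_nat_over N q -> 0 <= q.
Proof. by move=> [k ->]; rewrite divr_ge0 ?ler0n. Qed.

Lemma uniform_denominator (a b c d : rat) : 0 <= a -> 0 <= b -> 0 <= c -> 0 <= d ->
  exists N : nat, (0 < N)%N /\
   forall h : nat, h = 2%N \/ h = 3%N ->
   forall r : nat,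
   exists x y z w : rat,
     (in_nat_over N x /\ in_nat_over N y /\
      in_nat_over N z /\ in_nat_over N w) /\
     r%:R = x ^+ 2 + y ^+ 2 + z ^+ 2 + w ^+ 2 /\
     is_rat_power h (a * x + b * y + c * z + d * w).
Proof.
move=> a0 b0 c0 d0.
have [A [B [C [E [m [m0 -> -> -> ->]]]]]] := common_sixth_power_den a0 b0 c0 d0.
have [N N0 rep] := natural_coefficients_any A B C E.
exists (N 2 * N 3)%N; split; first by rewrite muln_gt0 !N0.
move=> h h23 r; have [x [y [z [w [e p]]]]] := rep h h23 r.
have den k : in_nat_over (N 2 * N 3) (k%:R / (N h)%:R).
  by case: h23 => ->; [|rewrite mulnC]; apply: in_nat_over_mulr.
exists (x%:R / (N h)%:R), (y%:R / (N h)%:R), (z%:R / (N h)%:R), (w%:R / (N h)%:R).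
do 2 split=> //.
have : is_rat_power h (m%:R ^+ 6 : rat).
  by case: h23 => ->; [exists (m%:R ^+ 3)|exists (m%:R ^+ 2)]; rewrite -exprM.
move/(rat_power_div p); congr is_rat_power; rewrite !mulrDl.
by congr (_ + _ + _ + _); rewrite mulrAC.
Qed.

Theorem theorem1p1 (a b c d : rat)
    (ha : 0 <= a) (hb : 0 <= b) (hc : 0 <= c) (hd : 0 <= d) :
  (forall h : nat, h = 2%N \/ h = 3%N ->
   forall r : rat, 0 <= r ->
   exists x y z w : rat,
     (0 <= x /\ 0 <= y /\ 0 <= z /\ 0 <= w) /\
     r = x ^+ 2 + y ^+ 2 + z ^+ 2 + w ^+ 2 /\
     is_rat_power h (a * x + b * y + c * z + d * w))
  /\
  (exists N : nat, (0 < N)%N /\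
   forall h : nat, h = 2%N \/ h = 3%N ->
   forall r : nat,
   exists x y z w : rat,
     (in_nat_over N x /\ in_nat_over N y /\
      in_nat_over N z /\ in_nat_over N w) /\
     r%:R = x ^+ 2 + y ^+ 2 + z ^+ 2 + w ^+ 2 /\
     is_rat_power h (a * x + b * y + c * z + d * w)).
Proof.
have [N [N0 rep]] := uniform_denominator ha hb hc hd; split; last by exists N.
(* r = p / q = (p q^(2 h - 1)) / q^(2 h), and dividing a representation by q^h
   divides the value of the linear form by an h-th power. *)
move=> h h23 r /nonneg_rat_frac[p [q [q0 er]]].
have [x [y [z [w [[ix [iy [iz iw]]] [e pw]]]]]] := rep h h23 (p * q ^ (2 * h).-1)%N.
have qh : (0 : rat) < q%:R ^+ h by rewrite exprn_gt0 ?ltr0n.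
exists (x / q%:R ^+ h), (y / q%:R ^+ h), (z / q%:R ^+ h), (w / q%:R ^+ h); split; [|split].
- have ge0 u : in_nat_over N u -> 0 <= u / q%:R ^+ h.
    by move=> iu; rewrite divr_ge0 ?(in_nat_over_ge0 iu) // ltW.
  by split; [|split; [|split]]; apply: ge0.
- rewrite !expr_div_n -!mulrDl -e er natrM natrX; case: h23 => -> /=; field; exact: natr_neq0.
rewrite !mulrA -!mulrDl; apply: rat_power_div pw _; exact: is_rat_power_exp.
Qed.
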